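(* Let $n\ge2$, let $k\ge1$ be an integer, and let $f\in L^1(\mathbb{R}^n)$ be real-valued with $\int_{\mathbb{R}^n}(1+|x|)^{k+2}|f(x)|\,dx<\infty$. Assume $\Lambda_k(f)\neq\emptyset$. For each $\alpha\in\Lambda_k(f)$ let $x^{*,\alpha}=(x^{*,\alpha}_1,\dots,x^{*,\alpha}_n)$ be given by $$x_i^{*,\alpha}=\frac{\mathcal{M}_{\alpha+e_i}(f)}{(k+1)\mathcal{M}_\alpha(f)},\qquad i=1,\dots,n.$$ Assume in addition: (a) for every $\alpha\in\Lambda_k(f)$ there is a constant $c_\alpha\in\mathbb{R}$ such that $$\frac{1}{(k+1)(k+2)}\mathcal{M}_{\alpha+e_i+e_j}(f)-\frac12\mathcal{M}_\alpha(f)\,x_i^{*,\alpha}x_j^{*,\alpha}=c_\alpha\delta_{ij}\qquad\text{for all } i,j=1,\dots,n;$$ (b) for every $\alpha\in(\mathbb{N}_0)^n$ with $|\alpha|=k$ and $\alpha\notin\Lambda_k(f)$, $\mathcal{M}_{\alpha+e_i}(f)=\mathcal{M}_{\alpha+\alpha'}(f)=0$ for all $i=1,\dots,n$ and all $\alpha'\in(\mathbb{N}_0)^n$ with $|\alpha'|=2$. For each $\alpha\in\Lambda_k(f)$ let $t^{*,\alpha}\in\mathbb{R}$ be given by $c_\alpha+t^{*,\alpha}\mathcal{M}_\alpha(f)=0$. Let $u(x,t)=\int_{\mathbb{R}^n}G_t(x-y)f(y)\,dy$ be the solution of $u_t=\Delta u$ in $\mathbb{R}^n\times(0,\infty)$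 with initial data $u(x,0)=f(x)$. Then for every $1\le p\le\infty$, $$\lim_{t\to\infty}t^{\frac{k+2}2+\frac n2(1-\frac1p)}\big\|u(\cdot,t)-\hat G^{(k)}_t(\cdot;x^*,t^* )\big\|_{L^p(\mathbb{R}^n)}=0.$$
   Context: $\mathbb{N}_0=\{0,1,2,\dots\}$, $e_i$ is the $i$-th unit vector, $\delta_{ij}$ the Kronecker delta, and standard multi-index notation is used. $G_t(x)=(4\pi t)^{-n/2}\exp(-|x|^2/(4t))$ for $t>0$, $x\in\mathbb{R}^n$, is the heat kernel. The $\alpha$-moment of $f$ is $\mathcal{M}_\alpha(f)=\int_{\mathbb{R}^n}x^\alpha f(x)\,dx$, and $\Lambda_k(f)=\{\alpha\in(\mathbb{N}_0)^n: |\alpha|=k,\ \mathcal{M}_\alpha(f)\ne0\}$. Given families $x^*=\{x^{*,\alpha}\in\mathbb{R}^n:\alpha\in\Lambda_k(f)\}$ and $t^*=\{t^{*,\alpha}\in\mathbb{R}:\alpha\in\Lambda_k(f)\}$, the $k$-th order modified heat kernel is $$\hat G^{(k)}_t(x;x^*,t^* )=\sum_{0\le|\alpha|\le k-1}\frac{(-1)^{|\alpha|}}{\alpha!}\mathcal{M}_\alpha(f)\,\partial_x^\alpha G_t(x)+\sum_{\alpha\in\Lambda_k(f)}\frac{(-1)^k}{\alpha!}\mathcal{M}_\alpha(f)\,(\partial_x^\alpha G_{t-t^{*,\alpha}})(x-x^{*,\alpha})$$ for $t>\max(\{0\}\cup\{t^{*,\alpha}:\alpha\in\Lambda_k(f)\})$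 and $x\in\mathbb{R}^n$. For $p=\infty$, $1/p=0$. *)

(* Defs.v *)
From HB Require Import structures.
From mathcomp Require Import all_boot all_order all_algebra.
From mathcomp Require Import all_classical all_reals all_analysis.

Set Implicit Arguments.
Unset Strict Implicit.
Unset Printing Implicit Defensive.
Import Order.TTheory GRing.Theory Num.Theory.
Import numFieldNormedType.Exports.

Local Open Scope classical_set_scope.
Local Open Scope ring_scope.

(* The sigma-algebra on R^n generated by the coordinate functions, i.e. the
   Borel sigma-algebra, set up as the library does for tuples. *)
Definition rV_display : measure_display.
Proof. exact: default_measure_display. Qed.

Section measurable_rV.
Variables (R : realType) (n : nat).

Let coors : 'I_n -> 'rV[R]_n -> R := fun i x => x 0 i.

Let rV_set0 : g_sigma_preimage coors set0.
Proof. exact: sigma_algebra0. Qed.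

Let rV_setC A : g_sigma_preimage coors A -> g_sigma_preimage coors (~` A).
Proof. exact: sigma_algebraC. Qed.

Let rV_bigcup (F : (set 'rV[R]_n)^nat) :
  (forall i, g_sigma_preimage coors (F i)) ->
  g_sigma_preimage coors (\bigcup_i (F i)).
Proof. exact: sigma_algebra_bigcup. Qed.

HB.instance Definition _ := @isMeasurable.Build rV_display
  'rV[R]_n (g_sigma_preimage coors) rV_set0 rV_setC rV_bigcup.

End measurable_rV.

Section measurable_rV_lemmas.
Context (R : realType).

Lemma measurable_coord n (i : 'I_n) :
  measurable_fun [set: 'rV[R]_n] (fun x : 'rV[R]_n => x 0 i).
Proof.
move=> _ Y mY; rewrite setTI; apply: sub_sigma_algebra => /=.
rewrite -bigcup_seq/=; exists i => /=; first by rewrite mem_index_enum.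
by exists Y => //; rewrite setTI.
Qed.

Lemma measurable_fun_coordP d (T : measurableType d) n (f : T -> 'rV[R]_n) :
  measurable_fun [set: T] f <->
  forall i, measurable_fun [set: T] (fun x => f x 0 i).
Proof.
split=> [mf i|mf].
  exact: (measurableT_comp (measurable_coord i) mf).
move=> _ A mA; rewrite setTI.
pose F := image_set_system setT f (@measurable _ T).
suff : F A by rewrite /F /image_set_system/= setTI.
move: A mA; apply: smallest_sub.
  exact/sigma_algebra_image/sigma_algebra_measurable.
move=> A; rewrite -bigcup_seq => -[i _ [B mB <-]].
by rewrite /F /image_set_system/= !setTI -[X in measurable X]setTI; exact: mf.
Qed.

(* The identification R * R^n = R^(n+1). *)
Definition rV_cons n (z : measurableTypeR R * 'rV[R]_n) : 'rV[R]_n.+1 :=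
  \row_i if unlift ord0 i is Some j then z.2 0 j else z.1.

Lemma measurable_rV_cons n : measurable_fun setT (@rV_cons n).
Proof.
apply/measurable_fun_coordP => i.
under eq_fun do rewrite mxE.
case: (unlift _ _) => [j|]; last exact: measurable_fst.
exact: (measurableT_comp (measurable_coord j)).
Qed.

Definition rV_uncons n (x : 'rV[R]_n.+1) : measurableTypeR R * 'rV[R]_n :=
  (x 0 ord0, \row_j x 0 (lift ord0 j)).

Lemma rV_consK n : cancel (@rV_cons n) (@rV_uncons n).
Proof.
move=> [a x]; rewrite /rV_uncons mxE unlift_none/=; congr pair.
by apply/rowP => j; rewrite !mxE liftK.
Qed.

Lemma measurable_rV_uncons n : measurable_fun setT (@rV_uncons n).
Proof.
apply: measurable_fun_pair; first exact: measurable_coord.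
apply/measurable_fun_coordP => i; under eq_fun do rewrite mxE.
exact: measurable_coord.
Qed.

End measurable_rV_lemmas.

Section cons_measure.
Context (R : realType) (n : nat).
Variable mu : {sigma_finite_measure set 'rV[R]_n -> \bar R}.

Definition cons_measure : set 'rV[R]_n.+1 -> \bar R :=
  pushforward (@lebesgue_measure R \x mu)%E (@rV_cons R n).

Let cons_measure0 : cons_measure set0 = 0%E.
Proof. by rewrite /cons_measure /pushforward preimage_set0 measure0. Qed.

Let cons_measure_ge0 A : (0 <= cons_measure A)%E.
Proof. by rewrite /cons_measure /pushforward measure_ge0. Qed.

Let cons_measure_sigma_additive : semi_sigma_additive cons_measure.
Proof.
pose m : {measure set _ -> \bar R} := (@lebesgue_measure R \x mu)%E.
exact: (@measure_semi_sigma_additive _ _ _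
  (measure_function_pushforward__canonical__measure_function_Measure m
    (@measurable_rV_cons R n))).
Qed.

HB.instance Definition _ := isMeasure.Build _ _ _ cons_measure
  cons_measure0 cons_measure_ge0 cons_measure_sigma_additive.

Let cons_measure_sigma_finite : sigma_finite setT cons_measure.
Proof.
have /sigma_finiteP[F [TF ndF Foo]] := sigma_finiteT (@lebesgue_measure R).
have /sigma_finiteP[G [TG ndG Goo]] := sigma_finiteT mu.
exists (fun k => @rV_uncons R n @^-1` (F k `*` G k)).
  rewrite -preimage_bigcup (_ : \bigcup_k _ = setT) ?preimage_setT//.
  apply/seteqP; split=> // -[x y] _.
  have [i _ Fix] : (\bigcup_i F i) x by rewrite -TF.
  have [j _ Gjy] : (\bigcup_i G i) y by rewrite -TG.
  exists (maxn i j) => //; split.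
  - by move: x Fix; exact/subsetPset/ndF/leq_maxl.
  - by move: y Gjy; exact/subsetPset/ndG/leq_maxr.
move=> k; have [mF Fk] := Foo k; have [mG Gk] := Goo k; split.
  rewrite -[X in measurable X]setTI; apply: measurable_rV_uncons => //.
  exact: measurableX.
rewrite /cons_measure /pushforward -comp_preimage.
rewrite (_ : _ \o _ = id) ?preimage_id; last exact/funext/rV_consK.
by rewrite product_measure1E// lte_mul_pinfty// ge0_fin_numE.
Qed.

HB.instance Definition _ := Measure_isSigmaFinite.Build _ _ _ cons_measure
  cons_measure_sigma_finite.

End cons_measure.

(* Lebesgue measure on R^n: the n-fold product of the one-dimensional one. *)
Fixpoint lebesgue_rV (R : realType) (n : nat) :
    {sigma_finite_measure set 'rV[R]_n -> \bar R} :=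
  match n with
  | 0 => \d_(0 : 'rV[R]_0)
  | n.+1 => cons_measure (lebesgue_rV R n)
  end.

Section multi_index.
Variable n : nat.

Definition mindex := {ffun 'I_n -> nat}.

Definition madd (a b : mindex) : mindex := [ffun i => (a i + b i)%N].
Definition munit (i : 'I_n) : mindex := [ffun j => (j == i) : nat].
Definition mdegree (a : mindex) : nat := (\sum_i a i)%N.
Definition mfact (a : mindex) : nat := (\prod_i (a i)`!)%N.

(* Makes the sums over multi-indices of bounded degree below (written with
   \sum_(_ \in _), which is 0 on infinite supports) genuine finite sums. *)
Lemma finite_mindex k : finite_set [set a : mindex | (mdegree a <= k)%N].
Proof.
pose g (h : {ffun 'I_n -> 'I_k.+1}) : mindex := [ffun i => h i : nat].
apply: (@sub_finite_set _ _ (g @` setT)); last exact: finite_image.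
move=> a /= ak; have aik i : (a i < k.+1)%N.
  by rewrite ltnS; apply: leq_trans ak; rewrite /mdegree (bigD1 i)//= leq_addr.
by exists [ffun i => Ordinal (aik i)] => //; apply/ffunP => i; rewrite !ffunE.
Qed.

End multi_index.

Section heat.
Context (R : realType) (n : nat).
Implicit Types (x y : 'rV[R]_n) (a : mindex n) (f : 'rV[R]_n -> R) (t : R).

(* The norm `|x| that the library puts on 'rV[R]_n is the sup norm. *)
Definition enorm x : R := Num.sqrt (\sum_i x 0 i ^+ 2).

Definition monom a x : R := \prod_i x 0 i ^+ a i.

Definition partial (i : 'I_n) f : 'rV[R]_n -> R := 'D_(delta_mx 0 i) f.

Definition mpartial a f : 'rV[R]_n -> R :=
  foldr (fun i g => iter (a i) (partial i) g) f (enum 'I_n).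

Definition heat_kernel t x : R :=
  (4 * pi * t) `^ (- (n%:R / 2)) * expR (- (enorm x ^+ 2 / (4 * t))).

Definition moment a f : R := \int[lebesgue_rV R n]_x (monom a x * f x).

Definition Lambda (k : nat) f : set (mindex n) :=
  [set a | mdegree a = k /\ moment a f != 0].

Definition modified_heat_kernel (k : nat) f
    (xs : mindex n -> 'rV[R]_n) (ts : mindex n -> R) t x : R :=
  \sum_(a \in [set a | (mdegree a <= k.-1)%N])
    ((-1) ^+ mdegree a / (mfact a)%:R * moment a f
     * mpartial a (heat_kernel t) x) +
  \sum_(a \in Lambda k f)
    ((-1) ^+ k / (mfact a)%:R * moment a f
     * mpartial a (heat_kernel (t - ts a)) (x - xs a)).

Definition heat_solution f x t : R :=
  \int[lebesgue_rV R n]_y (heat_kernel t (x - y) * f y).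

End heat.

(* Main.v *)
Require Import Defs.
From mathcomp Require Import all_boot all_order all_algebra.
From mathcomp Require Import all_classical all_reals all_analysis.
From mathcomp Require Import measurable_realfun ess_sup_inf.
From mathcomp Require Import ring lra.
Import Order.TTheory GRing.Theory Num.Theory.
Import numFieldNormedType.Exports.
Set Implicit Arguments.
Unset Strict Implicit.
Unset Printing Implicit Defensive.
Local Open Scope classical_set_scope.
Local Open Scope ring_scope.

(* Put m = k + 2 and G_t for the heat kernel. Every derivative of G_t is a
   product of one-dimensional ones, which obey Hermite's recursion and are
   dominated by t^(-|a|/2) times a Gaussian of twice the variance. Along a
   space-time segment s |-> (x - s y, t - s sg) the equation d_t G = Delta G
   turns d/ds into the constant-coefficient operator - sg Delta - y . grad, so
   one Taylor estimate serves twice.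
   With sg = 0 it expands G_t(x - y) in y up to order m. The remainder is at
   most C t^(-m/2) min(|y|^m, |y|^(m+1) / sqrt t) (G_t(x - y) + G_8t(x)), where
   for |y| > sqrt t each term is bounded separately. Integrated against f(y)
   this is o(t^(-m/2)) in L^1 and o(t^(-m/2 - n/2)) in L^oo, by dominated
   convergence; interpolation covers every p.
   With (y, sg) = (x^{*,a}, t^{*,a}) it expands the shifted terms of the modified
   kernel. By sum_{|a| = j} sum_i A(a + e_i) / a!
   = (j + 1) sum_{|b| = j + 1} A(b) / b! and hypotheses (a), (b), the result
   agrees with the moment expansion of the solution up to order m. *)

(** * Taylor's inequality *)

Section pointwise_derivation_rules.
Context {R : realType}.
Implicit Types (f g : R -> R) (x a b c d : R).

(** The derivation rules are put for functions in the form [fun s => ...], so that they chain by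
    application; the derivative that comes out is adjusted at the end. *)
Lemma is_derive_addf f g x a b : is_derive x 1 f a -> is_derive x 1 g b ->
  is_derive x 1 (fun s => f s + g s) (a + b).
Proof. exact: is_deriveD. Qed.

Lemma is_derive_mulf f g x a b : is_derive x 1 f a -> is_derive x 1 g b ->
  is_derive x 1 (fun s => f s * g s) (f x * b + g x * a).
Proof. exact: is_deriveM. Qed.

Lemma is_derive_cstf c x : is_derive x 1 (fun _ : R => c) (0 : R).
Proof. exact: is_derive_cst. Qed.

Lemma is_derive_scalef c f x a : is_derive x 1 f a ->
  is_derive x 1 (fun s => c * f s) (c * a).
Proof. exact: is_deriveZ. Qed.

Lemma is_derive_oppf f x a : is_derive x 1 f a ->
  is_derive x 1 (fun s => - f s) (- a).
Proof. exact: is_deriveN. Qed.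

Lemma is_derive_eqf f x a b : is_derive x 1 f a -> a = b -> is_derive x 1 f b.
Proof. by move=> ? <-. Qed.

Lemma is_derive_affine c d x : is_derive x 1 (fun s : R => c - s * d) (- d).
Proof.
have := is_derive_addf (is_derive_cstf c x)
  (is_derive_oppf (is_derive_mulf (is_derive_id x 1) (is_derive_cstf d x))).
by move=> /is_derive_eq; apply; ring.
Qed.

Lemma is_derive_expf (n : nat) x :
  is_derive x 1 (fun s : R => s ^+ n) (n%:R * x ^+ n.-1).
Proof.
elim: n => [|n IH]; first by rewrite mul0r; exact: is_derive_cstf.
rewrite (_ : (fun s => _) = (fun s : R => s * s ^+ n)); last first.
  by apply/funext => s; rewrite exprS.
have := is_derive_mulf (is_derive_id x 1) IH.
move=> /is_derive_eq; apply; rewrite /= -natr1.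
by case: n {IH} => [|n] /=; rewrite ?expr0 ?exprS; ring.
Qed.

Lemma is_derive_compf f g x a b : is_derive (g x) 1 f a ->
  is_derive x 1 g b -> is_derive x 1 (fun s => f (g s)) (a * b).
Proof. exact: is_derive1_comp. Qed.

Lemma is_derive_sumf (I : Type) (r : seq I) (h dh : I -> R -> R) x :
  (forall i, is_derive x 1 (h i) (dh i x)) ->
  is_derive x 1 (fun s => \sum_(i <- r) h i s) (\sum_(i <- r) dh i x).
Proof.
move=> H; elim: r => [|i r IH].
  rewrite big_nil (_ : (fun _ => _) = fun=> 0); first exact: is_derive_cstf.
  by apply/funext => s; rewrite big_nil.
rewrite big_cons (_ : (fun _ => _) = fun s => h i s + \sum_(j <- r) h j s).
  exact: is_derive_addf.
by apply/funext => s; rewrite big_cons.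
Qed.

Lemma is_derive_prodf (I : finType) (h dh : I -> R -> R) x :
  (forall i, is_derive x 1 (h i) (dh i x)) ->
  is_derive x 1 (fun s => \prod_i h i s)
    (\sum_i dh i x * \prod_(j | j != i) h j x).
Proof.
move=> H.
(* The induction runs over lists without repetition: there, leaving out the index [i] removes
   exactly one factor. *)
suff: forall r : seq I, uniq r ->
  is_derive x 1 (fun s => \prod_(i <- r) h i s)
    (\sum_(i <- r) dh i x * \prod_(j <- r | j != i) h j x).
  by apply; exact: index_enum_uniq.
elim=> [_|i r IH /= /andP[ir ur]].
  rewrite big_nil (_ : (fun _ => _) = fun=> 1); first exact: is_derive_cstf.
  by apply/funext => s; rewrite big_nil.
rewrite (_ : (fun _ => _) = fun s => h i s * \prod_(j <- r) h j s); last first.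
  by apply/funext => s; rewrite big_cons.
apply: is_derive_eq; first exact: is_derive_mulf (H i) (IH ur).
rewrite big_cons [in RHS]big_cons eqxx/= addrC mulrC; congr (_ * _ + _).
  rewrite big_seq_cond [RHS]big_seq_cond; apply: eq_bigl => j.
  by rewrite andbT; case: (boolP (j \in r)) => //= jr; apply/esym/eqP => E;
    move: ir; rewrite -E jr.
rewrite mulr_sumr !big_seq; apply: eq_bigr => j jr.
rewrite big_cons ifT; first by rewrite mulrCA.
by apply/eqP => E; move: ir; rewrite E jr.
Qed.

End pointwise_derivation_rules.

Section taylor.
Context {R : realType}.

(** Induction on [m]: the remainder of order m + 1 vanishes at 0, and its derivative is the
    remainder of order m of the shifted family [phi j.+1], so the mean value theorem bounds it by s
    B <= B. The factor 1/m! is given up. *)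
Lemma taylor_le (m : nat) : forall (phi : nat -> R -> R) (B : R),
  (forall (j : nat) (s : R), 0 <= s <= 1 -> is_derive s 1 (phi j) (phi j.+1 s)) ->
  (forall s : R, 0 <= s <= 1 -> `|phi m s| <= B) ->
  forall s : R, 0 <= s <= 1 ->
  `|phi 0%N s - \sum_(j < m) phi j 0 * s ^+ j / j`!%:R| <= B.
Proof.
elim: m => [|m IH] phi B dphi phiB s s01.
  by rewrite big_ord0 subr0; exact: phiB.
have {}IH := IH (fun j => phi j.+1) B (fun j => dphi j.+1) phiB.
pose psi (s : R) := phi 0%N s - \sum_(j < m.+1) phi j 0 * s ^+ j / j`!%:R.
pose dpsi (s : R) := phi 1%N s - \sum_(j < m) phi j.+1 0 * s ^+ j / j`!%:R.
have d (u : R) : 0 <= u <= 1 -> is_derive u 1 psi (dpsi u).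
  move=> u01; apply: is_derive_addf; first exact: dphi.
  apply: is_derive_oppf.
  have : is_derive u 1 (fun s : R => \sum_(j < m.+1) phi j 0 * s ^+ j / j`!%:R)
    (\sum_(j < m.+1) phi j 0 * (j%:R * u ^+ j.-1) / j`!%:R).
    apply: (@is_derive_sumf _ _ _ (fun (j : 'I_m.+1) s => phi j 0 * s ^+ (nat_of_ord j) / j`!%:R)
      (fun (j : 'I_m.+1) s => phi j 0 * (j%:R * s ^+ j.-1) / j`!%:R)) => j /=.
    apply: is_derive_eq.
      exact: (is_derive_mulf (is_derive_scalef (phi j 0)
        (is_derive_expf j u)) (is_derive_cstf _ _)).
    by rewrite mulr0 add0r /= mulrC mulr_natl.
  move=> /is_derive_eq; apply.
  rewrite big_ord_recl /= mul0r mulr0 mul0r add0r.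
  apply: eq_bigr => j _; rewrite /bump /= add1n factS natrM.
  have j0 : (j.+1%:R : R) != 0 by rewrite pnatr_eq0.
  have f0 : (j`!%:R : R) != 0 by rewrite pnatr_eq0 -lt0n fact_gt0.
  by field; rewrite f0 [X in X != 0](_ : _ = j.+1%:R) ?j0// -natr1 addrC.
have [s0 s1] := andP s01.
have dpsi_itv u : u \in `]0, s[ -> is_derive u 1 psi (dpsi u).
  move=> /[!in_itv]/= /andP[u0 us]; apply: d.
  by rewrite (ltW u0) (le_trans (ltW us)).
have cpsi : {within `[0, s], continuous psi}.
  apply: derivable_within_continuous => u /[!in_itv]/= /andP[u0 us].
  by have [] := d u; rewrite ?u0 ?(le_trans us).
have [c] := MVT_segment s0 dpsi_itv cpsi.
rewrite in_itv/= => /andP[c0 cs]; rewrite subr0.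
have -> : psi 0 = 0.
  rewrite /psi big_ord_recl expr0 fact0 mulr1 divr1.
  by rewrite big1 ?addr0 ?subrr// => j _; rewrite expr0n/= mulr0 mul0r.
rewrite subr0 /psi => ->; rewrite normrM (ger0_norm s0).
have c01 : 0 <= c <= 1 by rewrite c0 (le_trans cs).
rewrite -[B]mulr1; apply: ler_pM => //.
exact: IH.
Qed.

End taylor.

(** * The one-dimensional heat kernel *)

Section gauss1.
Context {R : realType}.
Implicit Types (t z y s : R) (j : nat).

Definition gauss1 t z : R := (4 * pi * t) `^ (- 2^-1) * expR (- (z ^+ 2 / (4 * t))).

(** The j-th space derivative of [gauss1 t], given by Hermite's recursion; [is_derive_dgauss1] with
    [sg = 0] confirms that it is one. *)
Fixpoint dgauss1 j t z : R :=
  match j with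
  | 0 => gauss1 t z
  | 1 => - (z / (2 * t)) * gauss1 t z
  | (i.+1 as i1).+1 =>
      - (2 * t)^-1 * (z * dgauss1 i1 t z + i1%:R * dgauss1 i t z)
  end.

Lemma dgauss1SS j t z : dgauss1 j.+2 t z =
  - (2 * t)^-1 * (z * dgauss1 j.+1 t z + j.+1%:R * dgauss1 j t z).
Proof. by []. Qed.

Lemma gauss1E t z : 0 < t ->
  gauss1 t z = (Num.sqrt (4 * pi * t))^-1 * expR (- (z ^+ 2 / (4 * t))).
Proof.
by move=> t0; rewrite /gauss1 powRN powR12_sqrt// !mulr_ge0 ?pi_ge0 ?ltW.
Qed.

Lemma gauss1_ge0 t z : 0 <= gauss1 t z.
Proof. by rewrite /gauss1 mulr_ge0 ?powR_ge0 ?expR_ge0. Qed.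

(** The chain rule produces a time derivative and a space derivative; the heat equation turns the
    former into [dgauss1 2]. *)
Lemma is_derive_gauss1 t sg z y s : 0 < t - s * sg ->
  is_derive s 1 (fun s => gauss1 (t - s * sg) (z - s * y))
    (- sg * dgauss1 2 (t - s * sg) (z - s * y)
     - y * dgauss1 1 (t - s * sg) (z - s * y)).
Proof.
move=> t0; rewrite /gauss1.
have p0 : 0 < 4 * pi * (t - s * sg) by rewrite !mulr_gt0 ?pi_gt0.
have d1 := @is_derive_compf _ (fun u => u `^ (- 2^-1))
  (fun s => 4 * pi * (t - s * sg)) _ _ _ (is_derive1_powR (- 2^-1) p0)
  (is_derive_scalef (4 * pi) (is_derive_affine t sg s)).
have d2 : is_derive s 1 (fun s => (4 * (t - s * sg))^-1)
    (- (4 * (t - s * sg)) ^- 2 * (4 * - sg)).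
  apply: is_deriveV; first by rewrite mulf_neq0 ?gt_eqF.
  exact: (is_derive_scalef 4 (is_derive_affine t sg s)).
have d3 := @is_derive_compf _ expR (fun s => - ((z - s * y) ^+ 2 / (4 * (t - s * sg))))
  _ _ _ (is_derive_expR _) (is_derive_oppf (is_derive_mulf
  (@is_derive_compf _ (fun u => u ^+ 2) (fun s => z - s * y) _ _ _
    (is_derive_expf 2 _) (is_derive_affine z y s)) d2)).
refine (is_derive_eqf (is_derive_mulf d1 d3) _).
rewrite dgauss1SS /= /gauss1.
(* The exponent -1/2 - 1 is split into the kernel's own power and an inverse, after which the power
   is an opaque factor [P] of a field identity. *)
rewrite powRD; last by rewrite (gt_eqF p0) implybT.
rewrite (powR_inv1 (ltW p0)).
have := @pi_gt0 R.
set T := t - s * sg in t0 *; set Z := z - s * y.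
set E := expR _; set P := _ `^ _.
move: (@pi R) @P => p P p1; clearbody P.
by field; rewrite (gt_eqF t0) (gt_eqF p1).
Qed.

Lemma is_derive_dgauss1 j t sg z y s : 0 < t - s * sg ->
  is_derive s 1 (fun s => dgauss1 j (t - s * sg) (z - s * y))
    (- sg * dgauss1 j.+2 (t - s * sg) (z - s * y)
     - y * dgauss1 j.+1 (t - s * sg) (z - s * y)).
Proof.
move=> t0.
pose P j := is_derive s 1 (fun s => dgauss1 j (t - s * sg) (z - s * y))
    (- sg * dgauss1 j.+2 (t - s * sg) (z - s * y)
     - y * dgauss1 j.+1 (t - s * sg) (z - s * y)).
have d2 : is_derive s 1 (fun s => (2 * (t - s * sg))^-1)
    (- (2 * (t - s * sg)) ^- 2 * (2 * - sg)).
  apply: is_deriveV; first by rewrite mulf_neq0 ?gt_eqF.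
  exact: (is_derive_scalef 2 (is_derive_affine t sg s)).
have dz := is_derive_affine z y s.
have P0 : P 0%N by exact: is_derive_gauss1.
(* Hermite's recursion reaches back two orders, so consecutive orders are carried in pairs. *)
suff: P j /\ P j.+1 by case.
elim: j => [|j [IH0 IH1]]; split=> //.
  rewrite /P /=.
  refine (is_derive_eqf
    (is_derive_mulf (is_derive_oppf (is_derive_mulf dz d2)) P0) _).
  rewrite !dgauss1SS /=; move: t0; set T := t - s * sg => t0; set Z := z - s * y.
  by field; rewrite gt_eqF.
rewrite /P.
refine (is_derive_eqf (is_derive_mulf (is_derive_oppf d2) (is_derive_addf
    (is_derive_mulf dz IH1) (is_derive_scalef j.+1%:R IH0))) _).
rewrite (dgauss1SS j.+2) !(dgauss1SS j.+1) (dgauss1SS j).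
move: t0; set T := t - s * sg => t0; set Z := z - s * y.
rewrite -[j.+2%:R]natr1 -[j.+3%:R]natr1 -[j.+2%:R]natr1.
by field; rewrite gt_eqF.
Qed.

(** It suffices that r <= e^r and i r <= r^2/8 + 2 i^2; the latter is half of (r/2 - 2i)^2 >= 0. *)
Lemma expr_expR_le (i : nat) (r : R) : 0 <= r ->
  r ^+ i * expR (- (r ^+ 2 / 8)) <= expR (2 * i%:R ^+ 2).
Proof.
move=> r0; rewrite expRN ler_pdivrMr ?expR_gt0// -expRD.
apply: (@le_trans _ _ (expR r ^+ i)).
  by apply: lerXn2r; rewrite ?nnegrE ?expR_ge0// (le_trans _ (expR_ge1Dx r))// lerDr.
rewrite -expRM_natl ler_expR.
by have := sqr_ge0 (r / 2 - 2 * i%:R); rewrite !expr2; lra.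
Qed.

(** Doubling the time keeps half of the Gaussian exponent; the other half, r^2/8 with r = |z| / sqrt
    t, absorbs r^i. The factor sqrt 2 is the ratio of the two normalisations. *)
Lemma expr_gauss1_le (i : nat) : exists2 C : R, 0 <= C &
  forall t z, 0 < t -> `|z| ^+ i * gauss1 t z <= C * Num.sqrt t ^+ i * gauss1 (2 * t) z.
Proof.
exists (Num.sqrt 2 * expR (2 * i%:R ^+ 2)); first by rewrite mulr_ge0 ?sqrtr_ge0 ?expR_ge0.
move=> t z t0.
have s0 : 0 < Num.sqrt t by rewrite sqrtr_gt0.
rewrite !gauss1E ?mulr_gt0//.
have p0 : 0 < 4 * pi * t by rewrite !mulr_gt0 ?pi_gt0.
rewrite (_ : 4 * pi * (2 * t) = 2 * (4 * pi * t)); last by ring.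
rewrite [X in _ <= _ * (X^-1 * _)]sqrtrM//.
set q := Num.sqrt (4 * pi * t).
have q0 : 0 < q by rewrite sqrtr_gt0.
have c0 : 0 < Num.sqrt 2 :> R by rewrite sqrtr_gt0.
rewrite [leRHS](_ : _ = q^-1 * (Num.sqrt t ^+ i * (expR (2 * i%:R ^+ 2) * expR (- (z ^+ 2 / (4 * (2 * t))))))); last first.
  by field; rewrite ?gt_eqF.
rewrite mulrCA ler_pM2l ?invr_gt0//.
have -> : expR (- (z ^+ 2 / (4 * t))) =
    expR (- (z ^+ 2 / (4 * (2 * t)))) * expR (- ((`|z| / Num.sqrt t) ^+ 2 / 8)).
  have -> : (`|z| / Num.sqrt t) ^+ 2 = z ^+ 2 / t.
    by rewrite exprMn exprVn sqr_sqrtr ?ltW// real_normK ?num_real.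
  rewrite -expRD; congr expR.
  by field; rewrite ?gt_eqF.
rewrite [leLHS](_ : _ = Num.sqrt t ^+ i * (expR (- (z ^+ 2 / (4 * (2 * t)))) *
    ((`|z| / Num.sqrt t) ^+ i * expR (- ((`|z| / Num.sqrt t) ^+ 2 / 8))))); last first.
  rewrite [X in _ = _ * (_ * (X * _))]exprMn exprVn.
  set A := expR _; set B := expR (- (_ / 8)).
  by field; rewrite ?expf_neq0 ?gt_eqF.
rewrite ler_pM2l ?exprn_gt0// [leRHS]mulrC ler_pM2l ?expR_gt0//.
by apply: expr_expR_le; rewrite divr_ge0// ltW.
Qed.

(** The power |z|^i is there for the induction on [j]: the recursion multiplies a lower derivative
    by z, which raises i by one. Each |z| costs sqrt t, and the prefactor 1/(2t) pays for two of
    them. *)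
Lemma dgauss1_le j : forall i : nat, exists2 C : R, 0 <= C &
  forall t z, 0 < t ->
    `|z| ^+ i * `|dgauss1 j t z| <= C * Num.sqrt t ^+ i * Num.sqrt t ^- j * gauss1 (2 * t) z.
Proof.
pose P j := forall i : nat, exists2 C : R, 0 <= C & forall t z, 0 < t ->
  `|z| ^+ i * `|dgauss1 j t z| <= C * Num.sqrt t ^+ i * Num.sqrt t ^- j * gauss1 (2 * t) z.
have P0 : P 0%N.
  move=> i; have [C C0 HC] := expr_gauss1_le i; exists C => // t z t0.
  by rewrite expr0 invr1 mulr1 [dgauss1 _ _ _]/= (ger0_norm (gauss1_ge0 _ _)) HC.
suff: P j /\ P j.+1 by case.
elim: j => [|j [IH0 IH1]]; split=> //; move=> i.
  have [C C0 HC] := expr_gauss1_le i.+1; exists (C / 2); first by rewrite divr_ge0.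
  move=> t z t0; rewrite [dgauss1 _ _ _]/= normrM (ger0_norm (gauss1_ge0 _ _)) normrN normrM.
  rewrite normfV [`|2 * t|]gtr0_norm ?mulr_gt0//.
  rewrite [leLHS](_ : _ = (2 * t)^-1 * (`|z| ^+ i.+1 * gauss1 t z)); last by rewrite exprS; ring.
  have s0 : 0 < Num.sqrt t by rewrite sqrtr_gt0.
  apply: (le_trans (ler_wpM2l _ (HC t z t0))); first by rewrite invr_ge0 mulr_ge0// ltW.
  rewrite le_eqVlt; apply/orP; left; apply/eqP.
  rewrite -[X in (2 * X)^-1](sqr_sqrtr (ltW t0)) expr2 exprS.
  by field; rewrite gt_eqF.
have [C1 C10 HC1] := IH1 i.+1; have [C2 C20 HC2] := IH0 i.
exists (2^-1 * (C1 + j.+1%:R * C2)).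
  by rewrite mulr_ge0 ?addr_ge0 ?mulr_ge0.
move=> t z t0.
have s0 : 0 < Num.sqrt t by rewrite sqrtr_gt0.
rewrite dgauss1SS normrM normrN normfV [`|2 * t|]gtr0_norm ?mulr_gt0//.
have : (2 * t)^-1 * (`|z| ^+ i.+1 * `|dgauss1 j.+1 t z| + j.+1%:R * (`|z| ^+ i * `|dgauss1 j t z|))
  <= (2 * t)^-1 * (C1 * Num.sqrt t ^+ i.+1 * Num.sqrt t ^- j.+1 * gauss1 (2 * t) z +
     j.+1%:R * (C2 * Num.sqrt t ^+ i * Num.sqrt t ^- j * gauss1 (2 * t) z)).
  rewrite ler_wpM2l ?invr_ge0 ?mulr_ge0 ?(ltW t0)//.
  by rewrite lerD ?HC1// ler_wpM2l// HC2.
move=> H; apply: le_trans (le_trans H _).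
  rewrite [leLHS]mulrCA; apply: ler_wpM2l; first by rewrite invr_ge0 mulr_ge0// ltW.
  apply: (le_trans (ler_wpM2l _ (ler_normD _ _))); first by rewrite exprn_ge0.
  by rewrite !normrM normr_nat exprS; lra.
rewrite le_eqVlt; apply/orP; left; apply/eqP.
rewrite -[X in (2 * X)^-1](sqr_sqrtr (ltW t0)) !exprS expr0.
by field; rewrite ?expf_neq0 ?gt_eqF.
Qed.

(** From z^2 <= 2 (z - y)^2 + 2 y^2, whose slack is (z - 2y)^2, together with u <= 2t and y^2 <= t,
    one gets z^2/(32t) <= (z - y)^2/(8u) + 1/16. The bound u >= t/2 compares the normalisations and
    yields sqrt 8. *)
Lemma gauss1_shift_le : exists2 C : R, 0 <= C &
  forall t u z y, 0 < t -> t / 2 <= u <= 2 * t -> y ^+ 2 <= t ->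
    gauss1 (2 * u) (z - y) <= C * gauss1 (8 * t) z.
Proof.
exists (Num.sqrt 8 * expR (1 / 16)); first by rewrite mulr_ge0 ?sqrtr_ge0 ?expR_ge0.
move=> t u z y t0 /andP[tu ut] yt.
have u0 : 0 < u by lra.
rewrite !gauss1E ?mulr_gt0//.
have p0 : 0 < 4 * pi * t :> R by rewrite !mulr_gt0 ?pi_gt0.
rewrite (_ : 4 * pi * (8 * t) = 8 * (4 * pi * t)); last by ring.
rewrite [X in _ <= _ * (X^-1 * _)]sqrtrM//.
have c0 : 0 < Num.sqrt 8 :> R by rewrite sqrtr_gt0.
rewrite [leRHS](_ : _ = (Num.sqrt (4 * pi * t))^-1 * (expR (1 / 16) * expR (- (z ^+ 2 / (4 * (8 * t)))))); last first.
  by field; rewrite ?gt_eqF ?sqrtr_gt0.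
apply: ler_pM; rewrite ?invr_ge0 ?sqrtr_ge0 ?expR_ge0//.
  rewrite lef_pV2 ?posrE ?sqrtr_gt0 ?mulr_gt0 ?pi_gt0//.
  rewrite ler_sqrt; last by rewrite ltW// !mulr_gt0 ?pi_gt0.
  by rewrite ler_pM2l ?mulr_gt0 ?pi_gt0//; lra.
rewrite -expRD ler_expR -subr_ge0.
have -> : 1 / 16 + - (z ^+ 2 / (4 * (8 * t))) - - ((z - y) ^+ 2 / (4 * (2 * u))) =
  ((4 * t * (z - y) ^+ 2 - z ^+ 2 * u) + 2 * t * u) / (32 * t * u).
  by field; rewrite ?gt_eqF.
apply: divr_ge0; last by rewrite ltW// !mulr_gt0.
have H1 : 0 <= (2 * t - u) * (z - y) ^+ 2 by rewrite mulr_ge0 ?sqr_ge0//; lra.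
have H2 : 0 <= u * (t - y ^+ 2) by rewrite mulr_ge0 ?(ltW u0)// subr_ge0.
have H3 : 0 <= u * (z - 2 * y) ^+ 2 by rewrite mulr_ge0 ?sqr_ge0 ?ltW.
rewrite [leRHS](_ : _ = 2 * ((2 * t - u) * (z - y) ^+ 2) +
  2 * (u * (t - y ^+ 2)) + u * (z - 2 * y) ^+ 2); last by ring.
by do ?apply: addr_ge0 => //; apply: mulr_ge0.
Qed.

Lemma gauss1_le t z : 0 < t -> gauss1 t z <= (Num.sqrt t)^-1.
Proof.
move=> t0; rewrite gauss1E// -[leRHS]mulr1.
apply: ler_pM; rewrite ?invr_ge0 ?sqrtr_ge0 ?expR_ge0//.
  rewrite lef_pV2 ?posrE ?sqrtr_gt0 ?mulr_gt0 ?pi_gt0//.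
  rewrite ler_sqrt; last by rewrite ltW// !mulr_gt0 ?pi_gt0.
  rewrite ler_peMl ?(ltW t0)//.
  by have := pi_ge2 R; lra.
by rewrite -expR0 ler_expR oppr_le0 divr_ge0 ?sqr_ge0// mulr_ge0// ltW.
Qed.

Lemma measurable_gauss1 t : measurable_fun setT (gauss1 t).
Proof.
apply: measurable_funM => //; apply: measurableT_comp => //.
by apply: measurableT_comp => //; apply: measurable_funM => //; exact: measurable_funX.
Qed.

Lemma integral_gauss1 t y : 0 < t ->
  (\int[lebesgue_measure]_z (gauss1 t (z - y))%:E = 1)%E.
Proof.
move=> t0; rewrite -(integral_normal_pdf y (Num.sqrt (2 * t))).
apply: eq_integral => z _; congr EFin.
rewrite /normal_pdf gt_eqF ?sqrtr_gt0 ?mulr_gt0//.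
rewrite /normal_peak /normal_fun gauss1E// sqr_sqrtr ?mulr_ge0 ?ltW//.
congr (_ ^-1 * expR _); first by congr Num.sqrt; ring.
by rewrite mulNr; congr (- (_ / _)); ring.
Qed.

End gauss1.

(** * Derivatives of the heat kernel along space-time segments *)

Section multi_index_lemmas.
Context {n : nat}.
Implicit Types (a b : mindex n) (i : 'I_n).

Lemma maddA a b c : madd a (madd b c) = madd (madd a b) c.
Proof. by apply/ffunP => i; rewrite !ffunE addnA. Qed.

Lemma mdegree_madd a b : mdegree (madd a b) = (mdegree a + mdegree b)%N.
Proof. by rewrite /mdegree -big_split/=; apply: eq_bigr => i _; rewrite ffunE. Qed.

Lemma mdegree_munit i : mdegree (munit i) = 1%N.
Proof.
rewrite /mdegree (bigD1 i)//= ffunE eqxx big1 ?addn0// => j ji.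
by rewrite ffunE (negbTE ji).
Qed.

End multi_index_lemmas.

Section dheat.
Context {R : realType} {n : nat}.
Implicit Types (t s sg : R) (x y : 'rV[R]_n) (a : mindex n) (A : mindex n -> R).

(** A closed formula for the derivative of order [a] of the heat kernel; the identification, for
    positive times, is [mpartial_heat_kernel]. *)
Definition dheat a t x : R := \prod_i dgauss1 (a i) t (x 0 i).

Lemma heat_kernelE t x : heat_kernel t x = \prod_i gauss1 t (x 0 i).
Proof.
rewrite /gauss1 big_split/= prodr_const card_ord.
rewrite -(big_morph expR (@expRD R) (@expR0 R)) sumrN -mulr_suml.
rewrite /heat_kernel /enorm sqr_sqrtr; last by apply: sumr_ge0 => i _; exact: sqr_ge0.
by rewrite -powR_mulrn ?powR_ge0// -powRrM mulNr [2^-1 * _]mulrC.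
Qed.

Lemma dheat0 t x : dheat [ffun=> 0%N] t x = heat_kernel t x.
Proof. by rewrite heat_kernelE; apply: eq_bigr => i _; rewrite ffunE. Qed.

Lemma heat_kernel_ge0 t x : 0 <= heat_kernel t x.
Proof. by rewrite heat_kernelE; apply: prodr_ge0 => i _; exact: gauss1_ge0. Qed.

Lemma dheat_munit a i t x : dheat (madd a (munit i)) t x =
  dgauss1 (a i).+1 t (x 0 i) * \prod_(j | j != i) dgauss1 (a j) t (x 0 j).
Proof.
rewrite /dheat (bigD1 i)//= !ffunE eqxx addn1; congr (_ * _).
by apply: eq_bigr => j ji; rewrite !ffunE (negbTE ji) addn0.
Qed.

Lemma dheat_munit2 a i t x : dheat (madd (madd a (munit i)) (munit i)) t x =
  dgauss1 (a i).+2 t (x 0 i) * \prod_(j | j != i) dgauss1 (a j) t (x 0 j).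
Proof.
rewrite dheat_munit !ffunE eqxx addn1; congr (_ * _).
by apply: eq_bigr => j ji; rewrite !ffunE (negbTE ji) addn0.
Qed.

(* [- sg * Laplacian - y . grad], acting on a family indexed by the
   derivatives that it stands for: the derivative of
   [s |-> dheat a (t - s * sg) (x - s *: y)]. *)
Definition path_step sg y A a : R :=
  - sg * (\sum_i A (madd (madd a (munit i)) (munit i)))
  - \sum_i y 0 i * A (madd a (munit i)).

Lemma is_derive_dheat a t sg x y s : 0 < t - s * sg ->
  is_derive s 1 (fun s : R => dheat a (t - s * sg) (x - s *: y))
    (path_step sg y (fun b => dheat b (t - s * sg) (x - s *: y)) a).
Proof.
move=> t0; rewrite (_ : (fun s : R => _) =
  (fun s : R => \prod_i dgauss1 (a i) (t - s * sg) (x 0 i - s * y 0 i))); last first.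
  by apply/funext => u; apply: eq_bigr => i _; rewrite !mxE.
refine (is_derive_eqf (@is_derive_prodf _ _
  (fun i s => dgauss1 (a i) (t - s * sg) (x 0 i - s * y 0 i))
  (fun i s => (- sg * dgauss1 (a i).+2 (t - s * sg) (x 0 i - s * y 0 i)
     - y 0 i * dgauss1 (a i).+1 (t - s * sg) (x 0 i - s * y 0 i)))
   _ (fun i => is_derive_dgauss1 _ _ _ t0)) _).
rewrite /path_step mulr_sumr -sumrB; apply: eq_bigr => i _.
rewrite dheat_munit2 dheat_munit !mxE mulrBl !mulrA.
by congr (_ * _ - _ * _); apply: eq_bigr => j _; rewrite !mxE.
Qed.

(** [path_step] has coefficients independent of s, so it commutes with d/ds and its iterates are the
    successive derivatives along the segment. *)
Lemma is_derive_iter_path_step j a t sg x y s : 0 < t - s * sg ->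
  is_derive s 1 (fun s : R =>
      iter j (path_step sg y) (fun b => dheat b (t - s * sg) (x - s *: y)) a)
    (iter j.+1 (path_step sg y) (fun b => dheat b (t - s * sg) (x - s *: y)) a).
Proof.
move=> t0; elim: j a => [|j IH] a; first exact: is_derive_dheat.
pose F (s : R) b := iter j (path_step sg y) (fun b => dheat b (t - s * sg) (x - s *: y)) b.
pose dF (s : R) b := iter j.+1 (path_step sg y) (fun b => dheat b (t - s * sg) (x - s *: y)) b.
refine (is_derive_addf
  (@is_derive_scalef _ (- sg) (fun s => \sum_i F s (madd (madd a (munit i)) (munit i))) s
    (\sum_i dF s (madd (madd a (munit i)) (munit i))) _)
  (@is_derive_oppf _ (fun s => \sum_i y 0 i * F s (madd a (munit i))) s
    (\sum_i y 0 i * dF s (madd a (munit i))) _)).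
  exact: (@is_derive_sumf _ _ _ (fun i s => F s (madd (madd a (munit i)) (munit i)))
    (fun i s => dF s (madd (madd a (munit i)) (munit i))) _ (fun i => IH _)).
exact: (@is_derive_sumf _ _ _ (fun i s => y 0 i * F s (madd a (munit i)))
  (fun i s => y 0 i * dF s (madd a (munit i)))
   _ (fun i => is_derive_scalef _ (IH _))).
Qed.

Lemma partial_dheat a i t : 0 < t ->
  partial i (dheat a t) = dheat (madd a (munit i)) t.
Proof.
move=> t0; apply/funext => x; rewrite /partial.
(* The directional derivative is the derivative along the segment with [sg = 0] and velocity minus
   the unit vector. *)
have -> : 'D_(delta_mx 0 i) (dheat a t) x =
    'D_1 (fun s : R => dheat a (t - s * 0) (x - s *: (- delta_mx 0 i))) 0.
  rewrite /derive; apply: (congr1 (fun F : R -> R => lim (F @ 0^'))).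
  apply/funext => h /=.
  by rewrite !mulr0 !subr0 scale0r subr0 scalerN opprK addr0 [_ *: 1]mulr1 [x + _]addrC.
have := @is_derive_dheat a t 0 x (- delta_mx 0 i) 0.
rewrite mul0r subr0 scale0r subr0 => /(_ t0) [_ ->].
rewrite /path_step oppr0 mul0r sub0r (bigD1 i)//= big1 ?addr0.
  by rewrite !mxE !eqxx/= mulN1r opprK.
by move=> j ji; rewrite !mxE (negbTE ji) andbF oppr0 mul0r.
Qed.

Lemma mpartial_heat_kernel a t : 0 < t -> mpartial a (heat_kernel t) = dheat a t.
Proof.
move=> t0.
(* Once the coordinates in [r] are treated, only they have been differentiated, each [i] exactly
   [a i] times since [r] has no repetition. *)
suff H (r : seq 'I_n) : uniq r ->
    foldr (fun i g => iter (a i) (partial i) g) (heat_kernel t) r =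
    dheat [ffun i => if i \in r then a i else 0%N] t.
  rewrite /mpartial H ?enum_uniq//; congr dheat.
  by apply/ffunP => i; rewrite ffunE mem_enum.
elim: r => [_|i r IH /= /andP[ir ur]].
  by apply/funext => x; rewrite /= -dheat0; congr dheat; apply/ffunP => i; rewrite !ffunE.
have it (k : nat) b : iter k (partial i) (dheat b t) = dheat [ffun j => (b j + (j == i) * k)%N] t.
  elim: k => [|k IHk].
    by congr dheat; apply/ffunP => j; rewrite ffunE muln0 addn0.
  rewrite iterS IHk partial_dheat//; congr dheat.
  by apply/ffunP => j; rewrite !ffunE mulnS addnCA addnC addnA.
rewrite IH// it; congr dheat; apply/ffunP => j; rewrite !ffunE in_cons.
have [->|ji] := eqVneq j i; first by rewrite (negbTE ir) mul1n.
by rewrite mul0n addn0.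
Qed.

Lemma enorm_ge0 x : 0 <= enorm x. Proof. exact: sqrtr_ge0. Qed.

Lemma le_coord_enorm x i : `|x 0 i| <= enorm x.
Proof.
rewrite -sqrtr_sqr ler_sqrt; last by apply: sumr_ge0 => j _; exact: sqr_ge0.
by rewrite (bigD1 i)//= lerDl; apply: sumr_ge0 => j _; exact: sqr_ge0.
Qed.

Lemma dheat_le a : exists2 C : R, 0 <= C & forall t x, 0 < t ->
  `|dheat a t x| <= C * Num.sqrt t ^- mdegree a * heat_kernel (2 * t) x.
Proof.
have /choice[C HC] : forall i : 'I_n, exists C : R, 0 <= C /\ forall t z, 0 < t ->
    `|dgauss1 (a i) t z| <= C * Num.sqrt t ^- a i * gauss1 (2 * t) z.
  move=> i; have [C C0 HC] := @dgauss1_le R (a i) 0%N; exists C; split=> // t z t0.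
  by have := HC t z t0; rewrite !expr0 mul1r mulr1.
exists (\prod_i C i); first by apply: prodr_ge0 => i _; case: (HC i).
move=> t x t0; rewrite /dheat normr_prod heat_kernelE /mdegree.
rewrite -exprVn -prodrXr -!big_split/=.
apply: ler_prod => i _; rewrite normr_ge0/= exprVn.
by case: (HC i) => _; exact.
Qed.

(** Each step adds either one space derivative with coefficient |y|, costing 1/sqrt t, or two with
    coefficient |sg|, costing 1/t. Hence one factor |y|/sqrt t + |sg|/t per step. *)
Lemma iter_path_step_le j a : exists2 C : R, 0 <= C & forall t sg x y, 0 < t ->
  `|iter j (path_step sg y) (fun b => dheat b t x) a| <=
    C * (enorm y / Num.sqrt t + `|sg| / t) ^+ j
      * Num.sqrt t ^- mdegree a * heat_kernel (2 * t) x.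
Proof.
elim: j a => [|j IH] a.
  have [C C0 HC] := dheat_le a; exists C => // t sg x y t0.
  by rewrite expr0 mulr1; exact: HC.
have /choice[C1 HC1] : forall i : 'I_n, exists C : R, 0 <= C /\ forall t sg x y, 0 < t ->
  `|iter j (path_step sg y) (fun b => dheat b t x) (madd a (munit i))| <=
    C * (enorm y / Num.sqrt t + `|sg| / t) ^+ j
      * Num.sqrt t ^- (mdegree a).+1 * heat_kernel (2 * t) x.
  move=> i; have [C C0 HC] := IH (madd a (munit i)); exists C; split=> //.
  by rewrite mdegree_madd mdegree_munit addn1 in HC.
have /choice[C2 HC2] : forall i : 'I_n, exists C : R, 0 <= C /\ forall t sg x y, 0 < t ->
  `|iter j (path_step sg y) (fun b => dheat b t x) (madd (madd a (munit i)) (munit i))| <=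
    C * (enorm y / Num.sqrt t + `|sg| / t) ^+ j
      * Num.sqrt t ^- (mdegree a).+2 * heat_kernel (2 * t) x.
  move=> i; have [C C0 HC] := IH (madd (madd a (munit i)) (munit i)); exists C; split=> //.
  by rewrite !mdegree_madd mdegree_munit !addn1 in HC.
exists (\sum_i C1 i + \sum_i C2 i).
  by rewrite addr_ge0// sumr_ge0// => i _; [case: (HC1 i)|case: (HC2 i)].
move=> t sg x y t0; have s0 : 0 < Num.sqrt t by rewrite sqrtr_gt0.
rewrite iterS /path_step; set A := iter j _ _.
set rho := _ / _ + _ / _; set G := heat_kernel _ _.
have r0 : 0 <= rho by rewrite addr_ge0// divr_ge0 ?enorm_ge0// ltW.
have G0 : 0 <= G by exact: heat_kernel_ge0.
have e1 : enorm y <= rho * Num.sqrt t.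
  by rewrite -ler_pdivrMr// lerDl divr_ge0// ltW.
have e2 : `|sg| <= rho * Num.sqrt t ^+ 2.
  by rewrite -ler_pdivrMr ?exprn_gt0// sqr_sqrtr ?(ltW t0)// lerDr divr_ge0 ?enorm_ge0 ?(ltW s0).
apply: (le_trans (ler_normB _ _)); rewrite normrM normrN.
rewrite [leRHS](_ : _ = (rho * Num.sqrt t ^+ 2) * (\sum_i C2 i * rho ^+ j
      * Num.sqrt t ^- (mdegree a).+2 * G) +
    (\sum_i (rho * Num.sqrt t) * (C1 i * rho ^+ j * Num.sqrt t ^- (mdegree a).+1 * G))); last first.
  rewrite -mulr_sumr -!mulr_suml !exprS.
  by field; rewrite ?expf_neq0 ?gt_eqF.
apply: lerD.
  apply: ler_pM => //; apply: (le_trans (ler_norm_sum _ _ _)).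
  by apply: ler_sum => i _; case: (HC2 i) => _; exact.
apply: (le_trans (ler_norm_sum _ _ _)); apply: ler_sum => i _; rewrite normrM.
apply: ler_pM => //; first exact: (le_trans (le_coord_enorm _ _)).
by case: (HC1 i) => _; exact.
Qed.

Lemma heat_kernel_shift_le : exists2 C : R, 0 <= C &
  forall t u x y, 0 < t -> t / 2 <= u <= 2 * t -> enorm y <= Num.sqrt t ->
    heat_kernel (2 * u) (x - y) <= C * heat_kernel (8 * t) x.
Proof.
have [C C0 HC] := @gauss1_shift_le R; exists (C ^+ n); first exact: exprn_ge0.
move=> t u x y t0 tu yt; rewrite !heat_kernelE.
have -> : C ^+ n = \prod_(i < n) C by rewrite prodr_const card_ord.
rewrite -big_split/=.
apply: ler_prod => i _; rewrite gauss1_ge0/= !mxE; apply: HC => //.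
rewrite -real_normK ?num_real// -[leRHS]sqr_sqrtr ?(ltW t0)//.
by apply: lerXn2r; rewrite ?nnegrE ?sqrtr_ge0// (le_trans (le_coord_enorm _ _)).
Qed.

Lemma heat_kernel2_le : exists2 C : R, 0 <= C & forall t x, 0 < t ->
  heat_kernel (2 * t) x <= C * heat_kernel (8 * t) x.
Proof.
have [C C0 H] := heat_kernel_shift_le; exists C => // t x t0.
rewrite -{1}[x]subr0; apply: H => //; first by apply/andP; split; lra.
by rewrite /enorm big1 ?sqrtr0 ?sqrtr_ge0// => i _; rewrite mxE expr0n.
Qed.

Lemma heat_kernel_le t x : 0 < t -> heat_kernel t x <= Num.sqrt t ^- n.
Proof.
move=> t0; rewrite heat_kernelE -exprVn.
have -> : (Num.sqrt t)^-1 ^+ n = \prod_(i < n) (Num.sqrt t)^-1.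
  by rewrite prodr_const card_ord.
by apply: ler_prod => i _; rewrite gauss1_ge0 gauss1_le.
Qed.

Lemma heat_kernel8_le t x : 0 < t ->
  heat_kernel (8 * t) x <= Num.sqrt t ^- n.
Proof.
move=> t0; apply: (le_trans (heat_kernel_le _ _)); first by rewrite mulr_gt0.
rewrite lef_pV2 ?posrE ?exprn_gt0 ?sqrtr_gt0 ?mulr_gt0//.
rewrite lerXn2r ?nnegrE ?sqrtr_ge0// ler_sqrt ?mulr_ge0 ?(ltW t0)//.
by rewrite ler_peMl ?(ltW t0)//; lra.
Qed.

(** [taylor_le] along the segment. Under the two smallness conditions the time stays within
    [t/2, 2t] and the shift within sqrt t, so every Gaussian met on the way is dominated by the one
    at time 8t. *)
Lemma dheat_taylor_le (m : nat) a : exists2 C : R, 0 <= C & forall t sg x y, 0 < t ->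
  `|sg| <= t / 2 -> enorm y <= Num.sqrt t ->
  `|dheat a (t - sg) (x - y) -
      \sum_(j < m) iter j (path_step sg y) (fun b => dheat b t x) a / j`!%:R| <=
    C * (enorm y / Num.sqrt t + `|sg| / t) ^+ m
      * Num.sqrt t ^- mdegree a * heat_kernel (8 * t) x.
Proof.
have [C C0 HC] := iter_path_step_le m a; have [C' C'0 HC'] := heat_kernel_shift_le.
(* The powers of 2 come from 1/sqrt(t - u sg) <= 2/sqrt t and 1/(t - u sg) <= 2/t on the segment. *)
exists (C * 2 ^+ m * 2 ^+ mdegree a * C'); first by rewrite !mulr_ge0// exprn_ge0.
move=> t sg x y t0 sgt yt; set B := leRHS.
have s0 : 0 < Num.sqrt t by rewrite sqrtr_gt0.
have tau u : 0 <= u <= 1 -> t / 2 <= t - u * sg <= 2 * t.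
  move=> /andP[u0 u1]; have := ler_norm sg; have := ler_norm (- sg); rewrite normrN => h1 h2.
  by apply/andP; split; nra.
have := @taylor_le R m (fun j s => iter j (path_step sg y)
  (fun b => dheat b (t - s * sg) (x - s *: y)) a) B.
have H1 : forall (j : nat) (s : R), 0 <= s <= 1 -> is_derive s 1 (fun s : R =>
      iter j (path_step sg y) (fun b => dheat b (t - s * sg) (x - s *: y)) a)
    (iter j.+1 (path_step sg y) (fun b => dheat b (t - s * sg) (x - s *: y)) a).
  move=> j s /tau /andP[h _]; apply: is_derive_iter_path_step.
  by apply: lt_le_trans h; rewrite divr_gt0.
move=> /(_ H1).
have H2 : forall s : R, 0 <= s <= 1 ->
  `|iter m (path_step sg y) (fun b => dheat b (t - s * sg) (x - s *: y)) a| <= B.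
  move=> u u01; have /andP[t1 t2] := tau _ u01; have [u0 u1] := andP u01.
  have t3 : 0 < t - u * sg by apply: lt_le_trans t1; rewrite divr_gt0.
  have sV : (Num.sqrt (t - u * sg))^-1 <= 2 * (Num.sqrt t)^-1.
    rewrite -[2 in leRHS]invrK -invfM lef_pV2 ?posrE ?mulr_gt0 ?invr_gt0 ?sqrtr_gt0//.
    rewrite -(@ler_sqr _ (2^-1 * Num.sqrt t)) ?nnegrE ?mulr_ge0 ?sqrtr_ge0 ?invr_ge0//.
    by rewrite exprMn !sqr_sqrtr ?ltW// expr2; lra.
  apply: (le_trans (HC _ _ _ _ t3)); rewrite /B.
  rewrite -exprVn.
  rewrite [leRHS](_ : _ = C * (2 * (enorm y / Num.sqrt t + `|sg| / t)) ^+ m *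
     (2 * (Num.sqrt t)^-1) ^+ mdegree a * (C' * heat_kernel (8 * t) x)); last first.
    by rewrite !exprMn exprVn; ring.
  have rho0 : 0 <= enorm y / Num.sqrt (t - u * sg) + `|sg| / (t - u * sg).
    by rewrite addr_ge0// divr_ge0 ?enorm_ge0 ?sqrtr_ge0// ltW.
  apply: ler_pM; rewrite ?heat_kernel_ge0 ?mulr_ge0 ?exprn_ge0 ?invr_ge0 ?sqrtr_ge0//.
    apply: ler_pM; rewrite ?heat_kernel_ge0 ?mulr_ge0 ?exprn_ge0 ?invr_ge0 ?sqrtr_ge0//.
      apply: ler_wpM2l => //; apply: lerXn2r; rewrite ?nnegrE//.
        by rewrite mulr_ge0// addr_ge0// divr_ge0 ?enorm_ge0// ltW.
      rewrite mulrDr; apply: lerD; first by rewrite mulrCA ler_wpM2l ?enorm_ge0.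
      rewrite mulrCA ler_wpM2l//.
      rewrite -[2 in leRHS]invrK -invfM lef_pV2 ?posrE ?mulr_gt0 ?invr_gt0//.
      by rewrite mulrC.
    by apply: lerXn2r; rewrite ?nnegrE ?mulr_ge0 ?invr_ge0 ?sqrtr_ge0.
  apply: HC' => //; first by rewrite t1.
  apply: le_trans yt; rewrite /enorm ler_sqrt; last by apply: sumr_ge0 => j _; exact: sqr_ge0.
  apply: ler_sum => i _; rewrite mxE exprMn ler_piMl ?sqr_ge0// expr_le1//.
move=> /(_ H2 1); rewrite ler01 lexx => /(_ isT).
rewrite mul1r scale1r mul0r subr0 scale0r subr0.
by under eq_bigr do rewrite expr1n mulr1.
Qed.

End dheat.

(** * Taylor expansion of the heat kernel in space *)

Section multinomial.
Context {R : realType} {n : nat}.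
Implicit Types (a b : mindex n) (A : mindex n -> R) (y : 'rV[R]_n).

Lemma finite_mdegree (j : nat) : finite_set [set a : mindex n | mdegree a = j].
Proof. by apply: sub_finite_set (@finite_mindex n j) => a /= ->. Qed.

Lemma fsum_mdegree (j : nat) A : \sum_(a \in [set a | mdegree a = j]) A a =
  \sum_(a <- finmap.enum_fset (fset_set [set a : mindex n | mdegree a = j])) A a.
Proof. by rewrite fsbig_finite//; exact: finite_mdegree. Qed.

Lemma mfact_gt0 a : (0 < mfact a)%N.
Proof. by apply: prodn_gt0 => i; exact: fact_gt0. Qed.

Lemma mfact_munit a i : mfact (madd a (munit i)) = ((a i).+1 * mfact a)%N.
Proof.
rewrite /mfact (bigD1 i)//= [in RHS](bigD1 i)//= !ffunE eqxx addn1 factS -mulnA.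
by congr (_ * (_ * _))%N; apply: eq_bigr => j ji; rewrite !ffunE (negbTE ji) addn0.
Qed.

Lemma monom_munit a i y : monom (madd a (munit i)) y = monom a y * y 0 i.
Proof.
rewrite /monom (bigD1 i)//= [in RHS](bigD1 i)//= !ffunE eqxx addn1 exprSr -!mulrA.
congr (_ * _); rewrite mulrC; congr (_ * _).
by apply: eq_bigr => j ji; rewrite !ffunE (negbTE ji) addn0.
Qed.

(** Substitute b = a + e_i, so that 1/a! = b_i/b!. The indices with b_i = 0 are not reached, but
    their weight is zero. *)
Lemma sum_munit_coord A (j : nat) i :
  \sum_(a \in [set a | mdegree a = j]) (mfact a)%:R^-1 * A (madd a (munit i)) =
  \sum_(b \in [set b | mdegree b = j.+1]) (b i)%:R * ((mfact b)%:R^-1 * A b).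
Proof.
rewrite -(@fsbig_widen _ _ _ _ [set b | mdegree b = j.+1 /\ (0 < b i)%N] [set b | mdegree b = j.+1]); last 2 first.
- by move=> b [].
- move=> b /= [bj nb]; have -> : b i = 0%N; last by rewrite mul0r.
  by apply/eqP; rewrite -leqn0 leqNgt; apply/negP => b0; exact: nb.
rewrite (@reindex_fsbig _ _ _ _ _ (fun a => madd a (munit i)) [set a | mdegree a = j]).
  apply: eq_fsbigr => a _; rewrite mfact_munit !ffunE eqxx addn1 natrM invfM !mulrA.
  by rewrite mulfV ?mul1r// pnatr_eq0.
split.
- by move=> a /= aj; rewrite mdegree_madd mdegree_munit aj addn1 !ffunE eqxx addn1.
- move=> a b _ _ /ffunP ab; apply/ffunP => l; have := ab l; rewrite !ffunE.
  exact: addIn.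
- move=> b /= [bj b0]; exists [ffun l => (b l - (l == i))%N].
    suff : (mdegree [ffun l => (b l - (l == i))%N]).+1 = j.+1 by move=> [].
    rewrite -bj -addn1 -(mdegree_munit i) -mdegree_madd; congr mdegree.
    apply/ffunP => l; rewrite !ffunE; have [->|_] := eqVneq l i; first by rewrite subnK.
    by rewrite subn0 addn0.
  apply/ffunP => l; rewrite !ffunE; have [->|_] := eqVneq l i; first by rewrite subnK.
  by rewrite subn0 addn0.
Qed.

(** Summing the previous identity over [i] produces the factor sum_i b_i = j + 1. *)
Lemma sum_munit A (j : nat) :
  \sum_(a \in [set a | mdegree a = j])
    (mfact a)%:R^-1 * (\sum_i A (madd a (munit i))) =
  j.+1%:R * \sum_(b \in [set b | mdegree b = j.+1]) (mfact b)%:R^-1 * A b.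
Proof.
transitivity (\sum_i \sum_(a \in [set a | mdegree a = j])
    (mfact a)%:R^-1 * A (madd a (munit i))).
  rewrite fsum_mdegree; under eq_bigr do rewrite mulr_sumr.
  by rewrite exchange_big/=; apply: eq_bigr => i _; rewrite fsum_mdegree.
under eq_bigr do rewrite sum_munit_coord fsum_mdegree.
rewrite exchange_big/= fsum_mdegree mulr_sumr !big_seq.
apply: eq_bigr => b; rewrite in_fset_set ?inE/=; [move=> bj|exact: finite_mdegree].
by rewrite -mulr_suml -natr_sum -/(mdegree b) bj.
Qed.

(** The multinomial theorem for the operator (- y . grad)^j, by induction with [sum_munit]. *)
Lemma iter_path_step0 (j : nat) y A :
  iter j (path_step 0 y) A [ffun=> 0%N] =
  \sum_(b \in [set b | mdegree b = j])
    (-1) ^+ j * j`!%:R / (mfact b)%:R * monom b y * A b.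
Proof.
elim: j A => [|j IH] A.
  rewrite (_ : [set b | mdegree b = 0%N] = [set [ffun=> 0%N]]).
    rewrite fsbig_set1 expr0 mul1r fact0 /mfact /monom !big1 ?divr1 ?mul1r//.
    - by move=> i _; rewrite ffunE expr0.
    - by move=> i _; rewrite ffunE fact0.
  apply/seteqP; split=> b /=.
    move=> /eqP; rewrite /mdegree sum_nat_eq0 => /forallP b0.
    by apply/ffunP => i; rewrite ffunE; exact/eqP/b0.
  by move=> ->; rewrite /mdegree big1// => i _; rewrite ffunE.
rewrite iterSr IH.
transitivity ((-1) ^+ j.+1 * j`!%:R * \sum_(b \in [set b | mdegree b = j])
   (mfact b)%:R^-1 * \sum_i (monom (madd b (munit i)) y * A (madd b (munit i)))).
  rewrite !fsum_mdegree mulr_sumr; apply: eq_bigr => b _.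
  rewrite /path_step oppr0 mul0r sub0r !mulrN exprS !mulN1r !mulNr; congr (- _).
  rewrite !mulr_sumr; apply: eq_bigr => i _; rewrite monom_munit; ring.
rewrite (sum_munit (fun b => monom b y * A b)) factS natrM.
rewrite !fsum_mdegree !mulr_sumr; apply: eq_bigr => b _.
by ring.
Qed.

End multinomial.

Section heat_taylor.
Context {R : realType} {n : nat}.
Implicit Types (t : R) (x y : 'rV[R]_n).

(** The first entry of the minimum keeps the weight integrable against f with m moments only; the
    second makes it tend to 0 at each y as t grows. *)
Definition weight (m : nat) t y : R :=
  Num.min (enorm y ^+ m) (enorm y ^+ m.+1 / Num.sqrt t).

Definition heat_taylor (m : nat) t x y : R :=
  \sum_(j < m) \sum_(b \in [set b : mindex n | mdegree b = j])
    (-1) ^+ j / (mfact b)%:R * monom b y * dheat b t x.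

Lemma weight_ge0 m t y : 0 <= weight m t y.
Proof.
by rewrite /weight le_min exprn_ge0 ?enorm_ge0// divr_ge0 ?exprn_ge0 ?enorm_ge0 ?sqrtr_ge0.
Qed.

Lemma heat_taylorE m t x y : heat_taylor m t x y =
  \sum_(j < m) iter j (path_step 0 y) (fun b => dheat b t x) [ffun=> 0%N] / j`!%:R.
Proof.
apply: eq_bigr => j _; rewrite iter_path_step0 !fsum_mdegree.
rewrite mulr_suml; apply: eq_bigr => b _.
have f0 : (j`!%:R : R) != 0 by rewrite pnatr_eq0 -lt0n fact_gt0.
have g0 : ((mfact b)%:R : R) != 0 by rewrite pnatr_eq0 -lt0n mfact_gt0.
by field; rewrite f0 g0.
Qed.

Lemma heat_taylor_le (m : nat) : exists2 C : R, 0 <= C & forall t x y, 0 < t ->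
  `|heat_kernel t (x - y) - heat_taylor m.+1 t x y| <=
    C * Num.sqrt t ^- m * weight m t y * (heat_kernel t (x - y) + heat_kernel (8 * t) x).
Proof.
have [C1 C10 H1] := @dheat_taylor_le R n m.+1 [ffun=> 0%N].
have /choice[C2 H2] : forall j : nat, exists C : R, 0 <= C /\ forall t sg x y, 0 < t ->
  `|iter j (path_step sg y) (fun b => dheat b t x) [ffun=> 0%N]| <=
    C * (enorm y / Num.sqrt t + `|sg| / t) ^+ j
      * Num.sqrt t ^- mdegree ([ffun=> 0%N] : mindex n) * heat_kernel (2 * t) x.
  by move=> j; have [C ? ?] := @iter_path_step_le R n j [ffun=> 0%N]; exists C.
have deg0 : mdegree ([ffun=> 0%N] : mindex n) = 0%N.
  by rewrite /mdegree big1// => i _; rewrite ffunE.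
rewrite deg0 in H1 H2.
have [C3 C30 H3] := @heat_kernel2_le R n.
have S0 : 0 <= \sum_(j < m.+1) C2 j by apply: sumr_ge0 => j _; case: (H2 j).
exists (C1 + 1 + C3 * \sum_(j < m.+1) C2 j).
  by rewrite !addr_ge0// mulr_ge0.
move=> t x y t0; have s0 : 0 < Num.sqrt t by rewrite sqrtr_gt0.
have G1 := @heat_kernel_ge0 R n t (x - y); have G2 := @heat_kernel_ge0 R n (8 * t) x.
rewrite heat_taylorE -[X in `|X - _|]dheat0 -[X in dheat _ X _]subr0.
set r := enorm y / Num.sqrt t; have r0 : 0 <= r by rewrite divr_ge0 ?enorm_ge0// ltW.
(* In the scale-free variable r = |y|/sqrt t the weight becomes min(r^m, r^(m+1)), and the two cases
   below are r <= 1 and r > 1. *)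
have wE : Num.sqrt t ^- m * weight m t y = Num.min (r ^+ m) (r ^+ m.+1).
  rewrite /weight minr_pMr ?invr_ge0 ?exprn_ge0 ?sqrtr_ge0// /r !exprMn !exprVn.
  congr Num.min; first by rewrite mulrC.
  by rewrite !exprS; field; rewrite ?expf_neq0 gt_eqF.
rewrite -[X in _ <= X * _]mulrA wE.
have [yt|yt] := leP (enorm y) (Num.sqrt t).
  have r1 : r <= 1 by rewrite ler_pdivrMr// mul1r.
  rewrite min_r; last by rewrite exprS ler_piMl ?exprn_ge0.
  apply: le_trans (H1 t 0 x y t0 _ yt) _; first by rewrite normr0 divr_ge0// ltW.
  rewrite normr0 mul0r addr0 expr0 invr1 mulr1.
  apply: ler_pM; rewrite ?G2 ?mulr_ge0 ?exprn_ge0 ?lerDr//.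
  by rewrite ler_wpM2r ?exprn_ge0// -addrA lerDl addr_ge0 ?mulr_ge0.
have r1 : 1 <= r by rewrite ler_pdivlMr// mul1r ltW.
rewrite min_l; last by rewrite exprS ler_peMl ?exprn_ge0.
apply: (le_trans (ler_normB _ _)); rewrite subr0 dheat0 (ger0_norm G1).
have rm : 1 <= r ^+ m by rewrite exprn_ege1.
apply: (@le_trans _ _ (r ^+ m * heat_kernel t (x - y) +
   C3 * (\sum_(j < m.+1) C2 j) * r ^+ m * heat_kernel (8 * t) x)).
  apply: lerD; first by rewrite ler_peMl.
  apply: (le_trans (ler_norm_sum _ _ _)).
  rewrite mulr_sumr !mulr_suml; apply: ler_sum => j _.
  have [C2j H2j] := H2 j.
  rewrite normrM normfV normr_nat ler_pdivrMr ?ltr0n ?fact_gt0//.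
  have jf : 1 <= j`!%:R :> R by rewrite ler1n fact_gt0.
  apply: (@le_trans _ _ (C3 * C2 j * r ^+ m * heat_kernel (8 * t) x)); last first.
    by rewrite ler_peMr// mulr_ge0// !mulr_ge0// exprn_ge0.
  apply: (le_trans (H2j _ _ _ _ t0)).
  rewrite normr0 mul0r addr0 expr0 invr1 mulr1.
  rewrite [leRHS](_ : _ = C2 j * r ^+ m * (C3 * heat_kernel (8 * t) x)); last by ring.
  apply: ler_pM; rewrite ?heat_kernel_ge0 ?mulr_ge0 ?exprn_ge0//.
    by rewrite ler_wpM2l// ler_weXn2l// -ltnS.
  exact: H3.
have h1 : 0 <= r ^+ m * heat_kernel t (x - y) by rewrite mulr_ge0// exprn_ge0.
have h2 : 0 <= r ^+ m * heat_kernel (8 * t) x by rewrite mulr_ge0// exprn_ge0.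
have h3 : 0 <= C3 * \sum_(j < m.+1) C2 j by rewrite mulr_ge0.
rewrite mulrDr; apply: lerD.
  rewrite -mulrA ler_peMl//; lra.
rewrite -!mulrA ![r ^+ m * _]mulrC mulrA -mulrA.
by rewrite [X in X <= _]mulrA ler_wpM2r// ?lerDr ?addr_ge0 // mulrC.
Qed.

End heat_taylor.

(** * Integration *)

Section integral_complements.
Local Open Scope ereal_scope.
Context d (T : measurableType d) (R : realType) (mu : {measure set T -> \bar R}).

Import HBNNSimple.

(* The library's [ge0_le_integral] is restricted to measurable functions. *)
Lemma ge0_le_integralT (f1 f2 : T -> \bar R) : (forall x, 0 <= f1 x) ->
  (forall x, f1 x <= f2 x) -> \int[mu]_x f1 x <= \int[mu]_x f2 x.
Proof.
move=> f10 f12; have f20 x : 0 <= f2 x by exact: le_trans (f12 x).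
rewrite !ge0_integralTE//; apply: ereal_sup_le => _ [h /= hf <-].
by exists h => //= x; exact: le_trans (f12 x).
Qed.

(* The majorant [B] spares us proving that the error [E] is measurable. *)
Lemma Lnorm_interpolation (E : T -> R) (B : T -> \bar R) (e dl : R) (p : \bar R) :
  (0 <= e)%R -> (0 <= dl)%R -> 1 <= p ->
  measurable_fun setT B -> (forall x, `|E x|%:E <= B x) ->
  (forall x, B x <= (e * dl)%:E) -> \int[mu]_x B x <= e%:E ->
  'N[mu]_p[EFin \o E] <= (e * dl `^ (1 - fine (p^-1)))%:E.
Proof.
move=> e0 dl0 p1 mB EB Bd IB.
have EBd x : (`|E x| <= e * dl)%R by rewrite -lee_fin (le_trans (EB x)).
have B0 x : 0 <= B x by apply: le_trans (EB x); rewrite lee_fin.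
rewrite unlock; case: p p1 => [r||] //=; last first.
  move=> _; rewrite subr0 powRr1//.
  (* The exponent p = +oo: its inverse is 0, and the norm is the essential supremum, or 0 by
     convention if the whole space is null. *)
  case: ifPn => [_|_]; last by rewrite lee_fin mulr_ge0.
  by apply/ess_supP; apply: aeW => x /=; rewrite lee_fin.
rewrite lee_fin => r1; have r0 : (0 < r)%R by exact: lt_le_trans r1.
rewrite fine_invr.
(* Pointwise |E|^r = |E|^(r-1) |E| <= (e dl)^(r-1) B, where the first factor uses the uniform bound
   and B is then integrated. *)
have H : \int[mu]_x `|E x|%:E `^ r <= (((e * dl) `^ (r - 1)) * e)%:E.
  apply: (@le_trans _ _ (\int[mu]_x (((e * dl) `^ (r - 1))%:E * B x))).
    apply: ge0_le_integralT => x; first exact: poweR_ge0.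
    rewrite poweR_EFin -mulr_powRB1// EFinM muleC.
    apply: lee_pmul; rewrite ?lee_fin ?powR_ge0//.
    by apply: ge0_ler_powR; rewrite ?nnegrE ?subr_ge0 ?mulr_ge0.
  rewrite ge0_integralZl// ?lee_fin ?powR_ge0// EFinM.
  by apply: lee_pmul; rewrite ?lee_fin ?powR_ge0// integral_ge0.
have {}H : (\int[mu]_x `|E x|%:E `^ r) `^ r^-1 <= (((e * dl) `^ (r - 1) * e)%:E) `^ r^-1.
  apply: gt0_ler_poweR; [by rewrite invr_ge0 ltW| | |by []]; rewrite in_itv/= leey andbT//.
    by apply: integral_ge0 => x _; rewrite lee_fin powR_ge0.
  by rewrite lee_fin mulr_ge0// powR_ge0.
apply: (le_trans H); rewrite poweR_EFin lee_fin.
rewrite powRM ?powR_ge0// -powRrM mulrBl mul1r mulfV ?gt_eqF//.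
rewrite powRM// mulrAC -powRD; last by rewrite subrK oner_eq0.
by rewrite subrK powRr1.
Qed.

Lemma Rintegral_sum (I : Type) (r : seq I) (f : I -> T -> R) :
  (forall i, mu.-integrable setT (EFin \o f i)) ->
  (\int[mu]_x (\sum_(i <- r) f i x) = \sum_(i <- r) \int[mu]_x f i x)%R.
Proof.
move=> If; elim: r => [|i r IH].
  rewrite big_nil -[RHS](fine0) -(integral0 mu setT); congr fine.
  by apply: eq_integral => x _; rewrite big_nil.
rewrite big_cons -IH -RintegralD//.
  by apply: eq_Rintegral => x _; rewrite big_cons.
have -> : EFin \o (fun x => \sum_(j <- r) f j x)%R =
    fun x => \sum_(j <- r) (EFin \o f j) x.
  by apply/funext => x /=; rewrite sumEFin.
exact: integrable_sum.
Qed.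

End integral_complements.

Section lebesgue_rV_heat.
Context {R : realType}.

(** The measure is by construction the image of a product under [rV_cons], so this is a change of
    variables followed by Tonelli's theorem. *)
Lemma integral_lebesgue_rVS n (F : 'rV[R]_n.+1 -> \bar R) :
  measurable_fun setT F -> (forall x, 0 <= F x)%E ->
  (\int[lebesgue_rV R n.+1]_x F x =
   \int[lebesgue_measure]_z \int[lebesgue_rV R n]_x F (rV_cons (z, x)))%E.
Proof.
move=> mF F0.
transitivity (\int[pushforward (@lebesgue_measure R \x lebesgue_rV R n)%E
  (@rV_cons R n)]_x F x)%E; first by [].
rewrite ge0_integral_pushforward ?preimage_setT//; last exact: measurable_rV_cons.
rewrite fubini_tonelli1//; last by move=> x; exact: F0.
exact: (measurableT_comp mF (@measurable_rV_cons R n)).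
Qed.

Lemma measurable_heat_kernel_comp d (T : measurableType d) n (t : R) (h : T -> 'rV[R]_n) :
  (forall i, measurable_fun setT (fun x => h x 0 i)) ->
  measurable_fun setT (fun x => heat_kernel t (h x)).
Proof.
move=> mh; under eq_fun do rewrite heat_kernelE.
apply: measurable_prod => i _; apply: measurableT_comp (mh i).
exact: measurable_gauss1.
Qed.

Lemma measurable_heat_kernelB n t (y : 'rV[R]_n) :
  measurable_fun setT (fun x : 'rV[R]_n => heat_kernel t (x - y)).
Proof.
apply: measurable_heat_kernel_comp => i; under eq_fun do rewrite !mxE.
by apply: measurable_funB => //; exact: measurable_coord.
Qed.

(** Induction on the dimension: the kernel splits off the Gaussian of the first coordinate. In
    dimension 0 it is the constant 1 and the measure a point mass. *)
Lemma integral_heat_kernel n t (y : 'rV[R]_n) : 0 < t ->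
  (\int[lebesgue_rV R n]_x (heat_kernel t (x - y))%:E = 1)%E.
Proof.
move=> t0; elim: n y => [|n IH] y.
  rewrite integral_dirac//.
    by rewrite diracT mul1e heat_kernelE big_ord0.
  by apply/measurable_EFinP; exact: measurable_heat_kernelB.
rewrite integral_lebesgue_rVS; last 2 first.
- by apply/measurable_EFinP; exact: measurable_heat_kernelB.
- by move=> x; rewrite lee_fin heat_kernel_ge0.
pose y' : 'rV[R]_n := \row_j y 0 (lift ord0 j).
rewrite -[RHS](integral_gauss1 (y 0 ord0) t0); apply: eq_integral => z _.
under eq_integral => x _.
  rewrite (_ : heat_kernel t (rV_cons (z, x) - y) =
    gauss1 t (z - y 0 ord0) * heat_kernel t (x - y')); last first.
    rewrite !heat_kernelE big_ord_recl !mxE unlift_none/=; congr (_ * _).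
    by apply: eq_bigr => i _; rewrite !mxE liftK.
  rewrite EFinM; over.
rewrite ge0_integralZl//.
- by rewrite IH mule1.
- by apply/measurable_EFinP; exact: measurable_heat_kernelB.
- by move=> x _; rewrite lee_fin heat_kernel_ge0.
- by rewrite lee_fin gauss1_ge0.
Qed.

Lemma integral_heat_kernel0 n (t : R) : 0 < t ->
  (\int[lebesgue_rV R n]_x (heat_kernel t x)%:E = 1)%E.
Proof.
move=> t0; rewrite -(@integral_heat_kernel n t 0)//.
by apply: eq_integral => x _; rewrite subr0.
Qed.

Lemma measurable_enorm n : measurable_fun setT (@enorm R n).
Proof.
rewrite (_ : @enorm R n = fun x => (\sum_i x 0 i ^+ 2) `^ 2^-1).
  apply: (measurableT_comp (measurable_powR _)).
  by apply: measurable_sum => i; apply: measurable_funX; exact: measurable_coord.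
apply/funext => x; rewrite powR12_sqrt//.
by apply: sumr_ge0 => i _; exact: sqr_ge0.
Qed.

Lemma measurable_weight n m t : measurable_fun setT (@weight R n m t).
Proof.
apply: measurable_minr; first by apply: measurable_funX; exact: measurable_enorm.
by apply: measurable_funM => //; apply: measurable_funX; exact: measurable_enorm.
Qed.

Lemma measurable_monom n (a : mindex n) : measurable_fun setT (@monom R n a).
Proof. by apply: measurable_prod => i _; apply: measurable_funX; exact: measurable_coord. Qed.

Lemma monom_le n (a : mindex n) m (y : 'rV[R]_n) : (mdegree a <= m)%N ->
  `|monom a y| <= (1 + enorm y) ^+ m.
Proof.
move=> am; have e1 : 1 <= 1 + enorm y by rewrite lerDl enorm_ge0.
apply: (@le_trans _ _ ((1 + enorm y) ^+ mdegree a)); last by rewrite ler_weXn2l.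
rewrite /monom normr_prod /mdegree -prodrXr; apply: ler_prod => i _.
rewrite normr_ge0/= normrX lerXn2r ?nnegrE// ?(le_trans ler01)//.
by rewrite (le_trans (le_coord_enorm _ _))// lerDr.
Qed.

Lemma weight_le n m t (y : 'rV[R]_n) : weight m t y <= (1 + enorm y) ^+ m.
Proof.
rewrite /weight ge_min; apply/orP; left.
by rewrite lerXn2r ?nnegrE ?enorm_ge0 ?addr_ge0 ?enorm_ge0// lerDr.
Qed.

Lemma cvg_sqrtV_pinfty : (Num.sqrt t)^-1 @[t --> +oo] --> (0 : R).
Proof.
apply/cvgrPdist_le => e e0; near=> t.
have t0 : 0 < t by near: t; exact: nbhs_pinfty_gt.
rewrite sub0r normrN ger0_norm ?invr_ge0 ?sqrtr_ge0//.
rewrite -[leRHS]invrK lef_pV2 ?posrE ?invr_gt0 ?sqrtr_gt0//.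
rewrite -[leLHS]ger0_norm ?invr_ge0 ?(ltW e0)// -sqrtr_sqr ler_sqrt ?(ltW t0)//.
Unshelve. all: by end_near. Qed.

End lebesgue_rV_heat.

(** * Moment expansion of the solution *)

Section heat_solution_expansion.
Context {R : realType} {n : nat} (m : nat) (f : 'rV[R]_n -> R).
Let mu := lebesgue_rV R n.
Hypothesis fint : mu.-integrable setT (EFin \o f).
Hypothesis fmom : (\int[mu]_x ((1 + enorm x) ^+ m * `|f x|)%:E < +oo)%E.
Implicit Types (t : R) (x y : 'rV[R]_n) (b : mindex n).

Let mf : measurable_fun setT f.
Proof. by apply/measurable_EFinP; case/integrableP: fint. Qed.

Let mnf : measurable_fun setT (fun y => `|f y|).
Proof. exact: measurableT_comp. Qed.

Lemma integrable_poly_weight :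
  mu.-integrable setT (EFin \o (fun y => (1 + enorm y) ^+ m * `|f y|)).
Proof.
apply/integrableP; split.
  apply/measurable_EFinP; apply: measurable_funM => //; apply: measurable_funX.
  by apply: measurable_funD => //; exact: measurable_enorm.
under eq_integral => y _.
  rewrite abse_EFin ger0_norm; first over.
  by rewrite mulr_ge0// exprn_ge0// addr_ge0 ?enorm_ge0.
by [].
Qed.

Lemma integrable_moment b : (mdegree b <= m)%N ->
  mu.-integrable setT (EFin \o (fun y => monom b y * f y)).
Proof.
move=> bm; apply: le_integrable integrable_poly_weight => //.
  by apply/measurable_EFinP; apply: measurable_funM => //; exact: measurable_monom.
move=> y _; rewrite !abse_EFin lee_fin !normrM normr_id.
rewrite ler_wpM2r// [leRHS]ger0_norm ?monom_le//.
by rewrite exprn_ge0// addr_ge0 ?enorm_ge0.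
Qed.

Lemma integrable_heat t x : 0 < t ->
  mu.-integrable setT (EFin \o (fun y => heat_kernel t (x - y) * f y)).
Proof.
move=> t0.
have I : mu.-integrable setT (fun y => (Num.sqrt t ^- n)%:E * (EFin \o f) y)%E.
  exact: integrableZl.
apply: le_integrable I => //.
  apply/measurable_EFinP; apply: measurable_funM => //.
  apply: measurable_heat_kernel_comp => i; under eq_fun do rewrite !mxE.
  by apply: measurable_funB => //; exact: measurable_coord.
move=> y _; rewrite -EFinM !abse_EFin lee_fin normrM [leRHS]normrM ler_wpM2r//.
by rewrite (ger0_norm (heat_kernel_ge0 _ _)) ger0_norm ?heat_kernel_le//.
Qed.

Definition moment_expansion (N : nat) t x : R :=
  \sum_(j < N) \sum_(b \in [set b : mindex n | mdegree b = j])
    (-1) ^+ j / (mfact b)%:R * moment b f * dheat b t x.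

Lemma integrable_heat_taylor_term t x (j : nat) b : mdegree b = j -> (j <= m)%N ->
  mu.-integrable setT (EFin \o (fun y => (-1) ^+ j / (mfact b)%:R * dheat b t x
    * (monom b y * f y))).
Proof.
move=> bj jm; apply: (@integrableZl _ _ _ mu _ measurableT _ (EFin \o (fun y => monom b y * f y))).
by apply: integrable_moment; rewrite bj.
Qed.

Let I_term t x (j : 'I_m.+1) : mu.-integrable setT (EFin \o (fun y =>
  \sum_(b <- finmap.enum_fset (fset_set [set b : mindex n | mdegree b = j]))
     (-1) ^+ j / (mfact b)%:R * dheat b t x * (monom b y * f y))).
Proof.
(* The filter on the degree supplies [mdegree b = j] when the integrability of a single term is
   asked for. *)
rewrite (_ : _ \o _ = (fun y => \sum_(b <- finmap.enum_fset (fset_set [set b : mindex n | mdegree b = j]) | mdegree b == j)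
     ((-1) ^+ j / (mfact b)%:R * dheat b t x * (monom b y * f y))%:E)%E).
  apply: integrable_sum => // b /eqP bj.
  by apply: integrable_heat_taylor_term => //; rewrite -ltnS.
apply/funext => y /=; rewrite sumEFin; congr EFin; rewrite big_seq [RHS]big_seq_cond.
apply: eq_bigl => b; have [H|//] := boolP (b \in _); apply/esym/eqP.
by move: H; rewrite in_fset_set ?inE//; exact: finite_mdegree.
Qed.

Lemma moment_expansionE t x : moment_expansion m.+1 t x =
  \int[mu]_y (heat_taylor m.+1 t x y * f y).
Proof.
transitivity (\int[mu]_y (\sum_(j < m.+1)
  \sum_(b <- finmap.enum_fset (fset_set [set b : mindex n | mdegree b = j]))
     (-1) ^+ j / (mfact b)%:R * dheat b t x * (monom b y * f y))); last first.
  apply: eq_Rintegral => y _; rewrite /heat_taylor mulr_suml; apply: eq_bigr => j _.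
  by rewrite fsum_mdegree mulr_suml; apply: eq_bigr => b _; ring.
rewrite Rintegral_sum; last by move=> j; exact: I_term.
apply: eq_bigr => j _; rewrite fsum_mdegree.
have E (F G : mindex n -> R) : (forall b, mdegree b = j -> F b = G b) ->
    \sum_(b <- finmap.enum_fset (fset_set [set b : mindex n | mdegree b = j])) F b =
    \sum_(b <- finmap.enum_fset (fset_set [set b : mindex n | mdegree b = j])) G b.
  move=> FG; rewrite !big_seq; apply: eq_bigr => b.
  by rewrite in_fset_set ?inE; [exact: FG|exact: finite_mdegree].
(* [Rintegral_sum] wants integrability for every index, so the terms of another degree are set to
   0. *)
transitivity (\int[mu]_y
  \sum_(b <- finmap.enum_fset (fset_set [set b : mindex n | mdegree b = j]))
   (if mdegree b == j then (-1) ^+ j / (mfact b)%:R * dheat b t x * (monom b y * f y) else 0)).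
  rewrite Rintegral_sum.
    apply: E => b bj; rewrite bj eqxx RintegralZl//; last by apply: integrable_moment; rewrite bj -ltnS.
    by rewrite /moment; ring.
  move=> b; case: eqP => bj; last exact: integrable0.
  by apply: integrable_heat_taylor_term => //; rewrite -ltnS.
by apply: eq_Rintegral => y _; apply: E => b ->; rewrite eqxx.
Qed.

Lemma integrable_heat_taylor t x :
  mu.-integrable setT (EFin \o (fun y => heat_taylor m.+1 t x y * f y)).
Proof.
rewrite (_ : _ \o _ = (fun y => \sum_(j < m.+1)
  (\sum_(b <- finmap.enum_fset (fset_set [set b : mindex n | mdegree b = j]))
     (-1) ^+ j / (mfact b)%:R * dheat b t x * (monom b y * f y))%R%:E)%E).
  by apply: integrable_sum => // j _; exact: I_term.
apply/funext => y /=; rewrite sumEFin; congr EFin.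
rewrite /heat_taylor mulr_suml; apply: eq_bigr => j _.
by rewrite fsum_mdegree mulr_suml; apply: eq_bigr => b _; ring.
Qed.

Definition weighted_mass t : R := \int[mu]_y (weight m t y * `|f y|).

Lemma integrable_weight t : mu.-integrable setT (EFin \o (fun y => weight m t y * `|f y|)).
Proof.
apply: le_integrable integrable_poly_weight => //.
  by apply/measurable_EFinP; apply: measurable_funM => //; exact: measurable_weight.
move=> y _; rewrite !abse_EFin lee_fin !normrM normr_id ler_wpM2r//.
rewrite (ger0_norm (weight_ge0 _ _ _)) ger0_norm ?weight_le//.
by rewrite exprn_ge0// addr_ge0 ?enorm_ge0.
Qed.

Lemma weighted_mass_ge0 t : 0 <= weighted_mass t.
Proof. by apply: Rintegral_ge0 => y _; rewrite mulr_ge0 ?weight_ge0. Qed.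

Lemma weighted_massE t :
  (\int[mu]_y (weight m t y * `|f y|)%:E)%E = (weighted_mass t)%:E.
Proof. by rewrite fineK//; exact: integrable_fin_num (integrable_weight t). Qed.

(** Dominated convergence along an arbitrary sequence of times going to infinity: the integrand is
    at most |y|^(m+1) |f| / sqrt t, hence tends to 0 pointwise, and (1 + |y|)^m |f| dominates it.
    This is the source of the little o. *)
Lemma cvg_weighted_mass : weighted_mass t @[t --> +oo] --> 0.
Proof.
apply/cvg_pinftyP => u uoo.
have DCT := @dominated_convergence _ _ R mu setT measurableT
  (fun i y => (weight m (u i) y * `|f y|)%:E) (cst 0%E)
  (EFin \o (fun y => (1 + enorm y) ^+ m * `|f y|)).
have m_ i : measurable_fun setT (fun y => (weight m (u i) y * `|f y|)%:E).
  by apply/measurable_EFinP; apply: measurable_funM => //; exact: measurable_weight.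
have sV : (Num.sqrt (u i))^-1 @[i --> \oo] --> (0 : R).
  exact: (cvg_pinftyP _ _).1 (@cvg_sqrtV_pinfty R) _ uoo.
have c_ : {ae mu, forall y, setT y ->
    (weight m (u i) y * `|f y|)%:E @[i --> \oo] --> (0 : \bar R)%E}.
  apply: aeW => y _; apply: cvg_EFin; first exact: nearW.
  have h : enorm y ^+ m.+1 * (Num.sqrt (u i))^-1 * `|f y| @[i --> \oo] --> (0 : R).
    have := cvgM (cvgM (cvg_cst (enorm y ^+ m.+1)) sV) (cvg_cst `|f y|).
    by rewrite mulr0 mul0r; exact.
  apply: squeeze_cvgr (cvg_cst 0) h; apply: nearW => i /=.
  by rewrite mulr_ge0 ?weight_ge0//= ler_wpM2r// /weight ge_min lexx orbT.
have d_ : {ae mu, forall y (i : nat), setT y -> (`|(weight m (u i) y * `|f y|)%:E| <=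
    ((1 + enorm y) ^+ m * `|f y|)%:E)%E}.
  apply: aeW => y i _ /=; rewrite lee_fin normrM normr_id ger0_norm ?weight_ge0//.
  by rewrite ler_wpM2r// weight_le.
have [_ _] := DCT m_ (@measurable_cst _ _ _ _ _ _) c_ integrable_poly_weight d_.
rewrite integral0 => H; rewrite /weighted_mass /Rintegral.
exact: (fine_cvg H).
Qed.

(** Integrate [heat_taylor_le] against f. Bounding both kernels by t^(-n/2) gives the uniform
    estimate; exchanging the integrals and using that both have mass 1 gives the L^1 estimate. The
    two kernels account for the constant 2C. *)
Lemma heat_solution_expansion : exists2 C : R, 0 <= C & forall t, 0 < t ->
  exists B : 'rV[R]_n -> \bar R, [/\ measurable_fun setT B,
    forall x, (`|heat_solution f x t - moment_expansion m.+1 t x|%:E <= B x)%E,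
    forall x, (B x <= (C * Num.sqrt t ^- m * weighted_mass t * Num.sqrt t ^- n)%:E)%E &
    (\int[mu]_x B x <= (C * Num.sqrt t ^- m * weighted_mass t)%:E)%E].
Proof.
have [C C0 HC] := @heat_taylor_le R n m.
exists (C * 2); first by rewrite mulr_ge0.
move=> t t0; have s0 : 0 < Num.sqrt t by rewrite sqrtr_gt0.
pose c := C * Num.sqrt t ^- m.
have c0 : 0 <= c by rewrite mulr_ge0// invr_ge0 exprn_ge0// ltW.
pose K x y := heat_kernel t (x - y) + heat_kernel (8 * t) x.
have K0 x y : 0 <= K x y by rewrite addr_ge0 ?heat_kernel_ge0.
pose F (z : 'rV[R]_n * 'rV[R]_n) : \bar R := (c * (weight m t z.2 * `|f z.2|) * K z.1 z.2)%:E.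
have F0 z : (0 <= F z)%E by rewrite lee_fin !mulr_ge0 ?weight_ge0.
have mKx y : measurable_fun setT (K ^~ y).
  apply: measurable_funD; first exact: measurable_heat_kernelB.
  by apply: measurable_heat_kernel_comp => i; exact: measurable_coord.
have mF : measurable_fun setT F.
  apply/measurable_EFinP; apply: measurable_funM.
    apply: measurable_funM => //.
    apply: (@measurableT_comp _ _ _ _ _ _ (fun y => weight m t y * `|f y|)) => //.
    by apply: measurable_funM => //; exact: measurable_weight.
  apply: measurable_funD; apply: measurable_heat_kernel_comp => i.
    under eq_fun do rewrite !mxE.
    by apply: measurable_funB; apply: measurableT_comp (measurable_coord i) _.
  exact: measurableT_comp (measurable_coord i) _.
(* Taking the inner integral of the nonnegative joint majorant as B makes its measurability part of
   Tonelli's theorem. *)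
exists (fubini_F mu F); split.
- exact: measurable_fun_fubini_tonelli_F.
- move=> x; rewrite moment_expansionE /heat_solution -RintegralB//; last 2 first.
  + exact: integrable_heat.
  + exact: integrable_heat_taylor.
  have I : mu.-integrable setT (EFin \o (fun y =>
      heat_kernel t (x - y) * f y - heat_taylor m.+1 t x y * f y)).
    apply: (@integrableB _ _ _ mu _ measurableT
      (EFin \o (fun y => heat_kernel t (x - y) * f y))
      (EFin \o (fun y => heat_taylor m.+1 t x y * f y))).
      exact: integrable_heat.
    exact: integrable_heat_taylor.
  rewrite EFin_normr_Rintegral//.
  apply: le_trans (le_abse_integral _ _ _) _ => //.
    by case/integrableP: I.
  apply: ge0_le_integralT => y //; rewrite lee_fin -mulrBl normrM.
  apply: (@le_trans _ _ (c * weight m t y * K x y * `|f y|)).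
    by rewrite ler_wpM2r// HC.
  by rewrite le_eqVlt; apply/orP; left; apply/eqP; ring.
- move=> x.
  apply: (@le_trans _ _ (\int[mu]_y ((c * (2 * Num.sqrt t ^- n))%:E * (weight m t y * `|f y|)%:E))%E).
    apply: ge0_le_integralT => y; first exact: F0.
    rewrite -EFinM lee_fin.
    rewrite [leRHS](_ : _ = c * (weight m t y * `|f y|) * (2 * Num.sqrt t ^- n)); last by ring.
    rewrite ler_wpM2l ?mulr_ge0 ?weight_ge0// mulrDl mul1r lerD ?heat_kernel_le//.
    exact: heat_kernel8_le.
  rewrite ge0_integralZl//; last 3 first.
  + by apply/measurable_EFinP; apply: measurable_funM => //; exact: measurable_weight.
  + by move=> y _; rewrite lee_fin mulr_ge0 ?weight_ge0.
  + by rewrite lee_fin !mulr_ge0// invr_ge0 exprn_ge0// ltW.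
  rewrite weighted_massE -EFinM lee_fin le_eqVlt; apply/orP; left; apply/eqP.
  by rewrite /c; ring.
- rewrite /fubini_F fubini_tonelli//.
  rewrite (_ : (\int[mu]_y _)%E = (\int[mu]_y ((c * 2)%:E * (weight m t y * `|f y|)%:E))%E); last first.
    apply: eq_integral => y _; rewrite /F /=.
    under eq_integral do rewrite EFinM.
    rewrite ge0_integralZl//; last 3 first.
    + exact/measurable_EFinP.
    + by move=> x _; rewrite lee_fin.
    + by rewrite lee_fin !mulr_ge0 ?weight_ge0.
    rewrite (_ : (\int[mu]_x (K x y)%:E)%E = 2%:E); first by rewrite -!EFinM; congr EFin; ring.
    rewrite /K; under eq_integral do rewrite EFinD.
    rewrite ge0_integralD//; first last.
    + by apply/measurable_EFinP; apply: measurable_heat_kernel_comp => i; exact: measurable_coord.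
    + by move=> x _; rewrite lee_fin heat_kernel_ge0.
    + by apply/measurable_EFinP; exact: measurable_heat_kernelB.
    + by move=> x _; rewrite lee_fin heat_kernel_ge0.
    by rewrite integral_heat_kernel// integral_heat_kernel0 ?mulr_gt0// -EFinD.
  rewrite ge0_integralZl//; last 3 first.
  + by apply/measurable_EFinP; apply: measurable_funM => //; exact: measurable_weight.
  + by move=> y _; rewrite lee_fin mulr_ge0 ?weight_ge0.
  + by rewrite lee_fin mulr_ge0.
  rewrite weighted_massE -EFinM lee_fin le_eqVlt; apply/orP; left; apply/eqP.
  by rewrite /c; ring.
Qed.

End heat_solution_expansion.

(** * The modified heat kernel *)

Section shifted_kernel.
Context {R : realType} {n : nat}.
Implicit Types (t sg : R) (x y : 'rV[R]_n) (a : mindex n).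

(* The part of the space-time Taylor expansion of [dheat a (t - sg) (x - y)]
   that decays like [t ^ (- (mdegree a + 2) / 2)] or slower: a time derivative
   weighs as much as two space derivatives. *)
Definition shift_expansion a sg y t x : R :=
  dheat a t x - \sum_i y 0 i * dheat (madd a (munit i)) t x
  + 2^-1 * (\sum_i \sum_j y 0 i * y 0 j * dheat (madd (madd a (munit i)) (munit j)) t x)
  - sg * \sum_i dheat (madd (madd a (munit i)) (munit i)) t x.

Lemma dheat_le8 a : exists2 C : R, 0 <= C & forall t x, 0 < t ->
  `|dheat a t x| <= C * Num.sqrt t ^- mdegree a * heat_kernel (8 * t) x.
Proof.
have [C1 C10 H1] := @dheat_le R n a; have [C2 C20 H2] := @heat_kernel2_le R n.
exists (C1 * C2); first by rewrite mulr_ge0.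
move=> t x t0; apply: (le_trans (H1 t x t0)).
rewrite [leRHS](_ : _ = C1 * Num.sqrt t ^- mdegree a * (C2 * heat_kernel (8 * t) x)); last by ring.
by rewrite ler_wpM2l ?H2// mulr_ge0// invr_ge0 exprn_ge0// sqrtr_ge0.
Qed.

(** Size O(t^(-d/2)) relative to the Gaussian at time 8t. Restricting to t >= 1 makes a faster rate
    imply a slower one. *)
Definition decay (d : nat) (F : R -> 'rV[R]_n -> R) :=
  exists2 C : R, 0 <= C & forall t x, 1 <= t ->
    `|F t x| <= C * Num.sqrt t ^- d * heat_kernel (8 * t) x.

Lemma decay_ext d F G : (forall t x, F t x = G t x) -> decay d F -> decay d G.
Proof. by move=> FG [C C0 H]; exists C => // t x t1; rewrite -FG H. Qed.

Lemma decayZ d c F : decay d F -> decay d (fun t x => c * F t x).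
Proof.
move=> [C C0 H]; exists (`|c| * C); first by rewrite mulr_ge0.
by move=> t x t1; rewrite normrM -!mulrA ler_wpM2l// mulrA H.
Qed.

Lemma decayD d F G : decay d F -> decay d G -> decay d (fun t x => F t x + G t x).
Proof.
move=> [C C0 H] [D D0 K]; exists (C + D); first by rewrite addr_ge0.
move=> t x t1; apply: (le_trans (ler_normD _ _)).
by rewrite mulrDl [leRHS]mulrDl; apply: lerD; [apply: H|apply: K].
Qed.

Lemma decay_sum d (I : Type) (r : seq I) (F : I -> R -> 'rV[R]_n -> R) :
  (forall i, decay d (F i)) -> decay d (fun t x => \sum_(i <- r) F i t x).
Proof.
move=> H; elim: r => [|i r IH].
  exists 0 => // t x t1; rewrite big_nil normr0 !mul0r//.
by apply: decay_ext (decayD (H i) IH) => t x; rewrite big_cons.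
Qed.

Lemma decayW d e F : (d <= e)%N -> decay e F -> decay d F.
Proof.
move=> de [C C0 H]; exists C => // t x t1; apply: (le_trans (H t x t1)).
rewrite ler_wpM2r ?heat_kernel_ge0// ler_wpM2l//.
have s1 : 1 <= Num.sqrt t by rewrite -sqrtr1 ler_sqrt// (le_trans ler01).
rewrite lef_pV2 ?posrE ?exprn_gt0 ?(lt_le_trans ltr01)//.
by rewrite ler_weXn2l.
Qed.

Lemma decay_dheat a : decay (mdegree a) (dheat a).
Proof.
have [C C0 H] := dheat_le8 a; exists C => // t x t1.
by apply: H; exact: lt_le_trans t1.
Qed.

Lemma decay_path_step d a sg y (F : mindex n -> R -> 'rV[R]_n -> R) :
  (forall b, (mdegree a < mdegree b)%N -> decay d (F b)) ->
  decay d (fun t x => path_step sg y (fun b => F b t x) a).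
Proof.
move=> H.
apply: (@decay_ext _ (fun t x => - sg * (\sum_i F (madd (madd a (munit i)) (munit i)) t x)
   + (-1) * \sum_i y 0 i * F (madd a (munit i)) t x)).
  by move=> t x; rewrite /path_step mulN1r.
apply: decayD; apply: decayZ; apply: decay_sum => i.
  by apply: H; rewrite !mdegree_madd !mdegree_munit !addn1.
by apply: decayZ; apply: H; rewrite !mdegree_madd !mdegree_munit !addn1.
Qed.

(** With L = - sg Delta - y . grad, the left sum is 1 + L + L^2/2. [shift_expansion] drops from
    L^2/2 exactly the terms containing sg, namely sg y . grad Delta and sg^2 Delta^2 / 2, which add
    three and four derivatives. *)
Lemma taylor3_shift_expansion a sg y :
  decay (mdegree a).+3 (fun t x =>
    \sum_(j < 3) iter j (path_step sg y) (fun b => dheat b t x) a / j`!%:R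
    - shift_expansion a sg y t x).
Proof.
pose D t x := fun b => dheat b t x : R.
apply: (@decay_ext _ (fun t x =>
   2^-1 * sg * (\sum_i y 0 i * \sum_j dheat (madd (madd (madd a (munit i)) (munit j)) (munit j)) t x)
   + - (2^-1 * sg) * \sum_i path_step sg y (D t x) (madd (madd a (munit i)) (munit i)))).
  move=> t x; rewrite !big_ord_recr big_ord0 /= add0r.
  have psE A b : path_step sg y A b =
    - sg * (\sum_i A (madd (madd b (munit i)) (munit i)))
    - \sum_i y 0 i * A (madd b (munit i)) by [].
  rewrite /shift_expansion [path_step sg y (path_step _ _ _) a]psE.
  have -> : \sum_i y 0 i * path_step sg y (fun b => dheat b t x) (madd a (munit i)) =
     - sg * (\sum_i y 0 i * \sum_j dheat (madd (madd (madd a (munit i)) (munit j)) (munit j)) t x)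
     - \sum_i \sum_j y 0 i * y 0 j * dheat (madd (madd a (munit i)) (munit j)) t x.
    rewrite mulr_sumr -sumrB; apply: eq_bigr => i _.
    rewrite psE mulrBr mulrCA; congr (_ - _).
    by rewrite mulr_sumr; apply: eq_bigr => j _; rewrite mulrA.
  rewrite [path_step sg y _ a]psE /D.
  rewrite !factS fact0 !muln1.
  by field.
apply: decayD; apply: decayZ; apply: decay_sum => i.
  apply: decayZ; apply: decay_sum => j.
  by have := decay_dheat (madd (madd (madd a (munit i)) (munit j)) (munit j));
    rewrite !mdegree_madd !mdegree_munit !addn1.
apply: (@decay_path_step _ _ _ _ (fun b => dheat b)) => b hb.
apply: decayW (decay_dheat b); apply: leq_trans hb.
by rewrite !mdegree_madd !mdegree_munit !addn1.
Qed.

(** The threshold on t ensures at once t >= 1, |sg| <= t/2 and |y| <= sqrt t, as Taylor's estimate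
    of order 3 and [decay] require. *)
Lemma shift_expansion_le a sg y : exists2 C : R, 0 <= C & forall t x,
  1 + 2 * `|sg| + enorm y ^+ 2 <= t ->
  `|shift_expansion a sg y t x - dheat a (t - sg) (x - y)| <=
    C * Num.sqrt t ^- (mdegree a).+3 * heat_kernel (8 * t) x.
Proof.
have [C1 C10 H1] := @dheat_taylor_le R n 3 a.
have [C2 C20 H2] := taylor3_shift_expansion a sg y.
exists (C1 * (enorm y + `|sg|) ^+ 3 + C2).
  by rewrite addr_ge0// mulr_ge0// exprn_ge0// addr_ge0 ?enorm_ge0.
move=> t x tge; have y0 := enorm_ge0 y; have sg0 := normr_ge0 sg.
have y2 : 0 <= enorm y ^+ 2 by exact: sqr_ge0.
have t1 : 1 <= t by lra.
have t0 : 0 < t by lra.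
have s1 : 1 <= Num.sqrt t by rewrite -sqrtr1 ler_sqrt// ltW.
have s0 : 0 < Num.sqrt t by lra.
have yt : enorm y <= Num.sqrt t.
  by rewrite -(ger0_norm y0) -sqrtr_sqr ler_sqrt ?(ltW t0)//; lra.
have sgt : `|sg| <= t / 2 by lra.
have {}H1 := H1 t sg x y t0 sgt yt; have {}H2 := H2 t x t1.
rewrite distrC.
set T := \sum_(j < 3) _ in H1 H2.
rewrite (_ : _ - _ = (dheat a (t - sg) (x - y) - T) + (T - shift_expansion a sg y t x)); last by ring.
apply: (le_trans (ler_normD _ _)).
rewrite mulrDl [leRHS]mulrDl; apply: lerD => //; apply: (le_trans H1).
rewrite ler_wpM2r ?heat_kernel_ge0//.
rewrite [leRHS](_ : _ = C1 * ((enorm y + `|sg|) / Num.sqrt t) ^+ 3 * Num.sqrt t ^- mdegree a); last first.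
  by rewrite !exprS expr0; field; rewrite ?expf_neq0 ?gt_eqF.
rewrite ler_wpM2r ?invr_ge0 ?exprn_ge0 ?(ltW s0)// ler_wpM2l//.
(* For t >= 1 this replaces |sg|/t by |sg|/sqrt t, so the third power of the step size is
   O(t^(-3/2)). *)
have ts : Num.sqrt t <= t by rewrite -[leRHS](sqr_sqrtr (ltW t0)) expr2 ler_peMr ?(ltW s0).
rewrite lerXn2r ?nnegrE ?addr_ge0 ?divr_ge0 ?addr_ge0 ?(ltW t0) ?(ltW s0)//.
by rewrite mulrDl lerD// ler_wpM2l// lef_pV2.
Qed.

End shifted_kernel.

(** * Matching the moments of orders k, k + 1 and k + 2 *)

Section moment_matching.
Context {R : realType} {n : nat} (k : nat) (f : 'rV[R]_n -> R).
Variables (xs : mindex n -> 'rV[R]_n) (c ts : mindex n -> R).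
Hypothesis k1 : (1 <= k)%N.
Hypothesis xsE : forall a, Lambda k f a -> forall i : 'I_n,
  xs a 0 i = moment (madd a (munit i)) f / (k.+1%:R * moment a f).
Hypothesis cE : forall a, Lambda k f a -> forall i j : 'I_n,
  (k.+1%:R * k.+2%:R)^-1 * moment (madd (madd a (munit i)) (munit j)) f
    - 2^-1 * moment a f * xs a 0 i * xs a 0 j = c a * (i == j)%:R.
Hypothesis moment0 : forall a : mindex n, mdegree a = k -> ~ Lambda k f a ->
  (forall i : 'I_n, moment (madd a (munit i)) f = 0) /\
  (forall a' : mindex n, mdegree a' = 2%N -> moment (madd a a') f = 0).
Hypothesis tsE : forall a, Lambda k f a -> c a + ts a * moment a f = 0.

Lemma fsum_mdegree_le (N : nat) (F : mindex n -> R) :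
  \sum_(a \in [set a | (mdegree a <= N)%N]) F a =
  \sum_(j < N.+1) \sum_(a \in [set a | mdegree a = j]) F a.
Proof.
elim: N => [|N IH].
  rewrite big_ord1; congr (\sum_(a \in _) F a); apply/seteqP.
  by split=> a /=; rewrite leqn0 => /eqP.
rewrite big_ord_recr/= -IH -fsbigU0; last 3 first.
- exact: finite_mindex.
- exact: finite_mdegree.
- by move=> a /= [aN aE]; rewrite aE ltnn in aN.
congr (\sum_(a \in _) F a); apply/seteqP; split=> a /=.
  by rewrite leq_eqVlt ltnS => /orP[/eqP|]; [right|left].
by move=> [aN|->//]; exact: leqW.
Qed.

Lemma sum_Lambda (F G : mindex n -> R) :
  (forall a, Lambda k f a -> F a = G a) ->
  (forall a, mdegree a = k -> ~ Lambda k f a -> F a = 0) ->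
  \sum_(a \in [set a | mdegree a = k]) F a = \sum_(a \in Lambda k f) G a.
Proof.
move=> FG F0; rewrite -(@fsbig_widen _ _ _ _ (Lambda k f)).
- by apply: eq_fsbigr => a /set_mem; exact: FG.
- by move=> a [].
- by move=> a /= [ak aL]; exact: F0.
Qed.

Lemma finite_Lambda : finite_set (Lambda k f).
Proof. by apply: sub_finite_set (finite_mdegree k) => a []. Qed.

Lemma fsum_LambdaE (F : mindex n -> R) : \sum_(a \in Lambda k f) F a =
  \sum_(a <- finmap.enum_fset (fset_set (Lambda k f))) F a.
Proof. by rewrite fsbig_finite//; exact: finite_Lambda. Qed.

(** Orders below k cancel. Orders k, k + 1 and k + 2 are each rewritten as sums over [Lambda k f]
    and become the terms of [shift_expansion] with zero, one and two extra space derivatives. *)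
Lemma moment_expansion_modified t x : 0 < t ->
  (forall a, Lambda k f a -> 0 < t - ts a) ->
  moment_expansion f (k + 2).+1 t x - modified_heat_kernel k f xs ts t x =
  \sum_(a \in Lambda k f) (-1) ^+ k / (mfact a)%:R * moment a f *
    (shift_expansion a (ts a) (xs a) t x - dheat a (t - ts a) (x - xs a)).
Proof.
move=> t0 tts.
have k1n : (k.+1%:R : R) != 0 by rewrite pnatr_eq0.
have k2n : (k.+2%:R : R) != 0 by rewrite pnatr_eq0.
have mn a : Lambda k f a -> moment a f != 0 by case.
rewrite /moment_expansion addn2 !big_ord_recr/=.
rewrite /modified_heat_kernel.
have -> : \sum_(a \in [set a | (mdegree a <= k.-1)%N])
    ((-1) ^+ mdegree a / (mfact a)%:R * moment a f * mpartial a (heat_kernel t) x) =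
  \sum_(j < k) \sum_(b \in [set b : mindex n | mdegree b = j])
    (-1) ^+ j / (mfact b)%:R * moment b f * dheat b t x.
  (* As k >= 1, the degrees up to [k.-1] are exactly those below k. *)
  rewrite fsum_mdegree_le prednK//; apply: eq_bigr => j _.
  by apply: eq_fsbigr => a /set_mem/= ->; rewrite mpartial_heat_kernel.
have -> : \sum_(a \in Lambda k f) ((-1) ^+ k / (mfact a)%:R * moment a f
     * mpartial a (heat_kernel (t - ts a)) (x - xs a)) =
   \sum_(a \in Lambda k f) ((-1) ^+ k / (mfact a)%:R * moment a f
     * dheat a (t - ts a) (x - xs a)).
  by apply: eq_fsbigr => a /set_mem La; rewrite mpartial_heat_kernel//; exact: tts.
have -> : \sum_(b \in [set b | mdegree b = k])
    (-1) ^+ k / (mfact b)%:R * moment b f * dheat b t x =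
  \sum_(a \in Lambda k f) (-1) ^+ k / (mfact a)%:R * moment a f * dheat a t x.
  apply: sum_Lambda => // a ak aL.
  have [->|m0] := eqVneq (moment a f) 0; first by rewrite mulr0 mul0r.
  by exfalso; exact: aL.
have -> : \sum_(b \in [set b | mdegree b = k.+1])
    (-1) ^+ k.+1 / (mfact b)%:R * moment b f * dheat b t x =
  \sum_(a \in Lambda k f) (-1) ^+ k / (mfact a)%:R * moment a f *
     - \sum_i xs a 0 i * dheat (madd a (munit i)) t x.
  (* [sum_munit] brings order k + 1 down to order k; the choice of [xs] then absorbs the factor 1/(k
     + 1), and (b) removes the indices outside [Lambda k f]. *)
  transitivity ((-1) ^+ k.+1 / k.+1%:R * (\sum_(a \in [set a | mdegree a = k])
    (mfact a)%:R^-1 * \sum_i moment (madd a (munit i)) f * dheat (madd a (munit i)) t x)).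
    rewrite (sum_munit (fun b => moment b f * dheat b t x)) mulrA divfK//.
    by rewrite !fsum_mdegree mulr_sumr; apply: eq_bigr => b _; ring.
  rewrite fsum_mdegree mulr_sumr -fsum_mdegree; apply: sum_Lambda.
    move=> a La; rewrite exprS mulN1r !mulrN !mulNr; congr (- _).
    rewrite !mulr_sumr; apply: eq_bigr => i _; rewrite xsE//.
    by field; rewrite mn// pnatr_eq0 -lt0n mfact_gt0/= -[1 + _]/(1 + k%:R) nat1r k1n.
  move=> a ak aL; rewrite big1 ?mulr0// => i _.
  by have [-> _] := moment0 ak aL; rewrite mul0r.
have -> : \sum_(b \in [set b | mdegree b = k.+2])
    (-1) ^+ k.+2 / (mfact b)%:R * moment b f * dheat b t x =
  \sum_(a \in Lambda k f) (-1) ^+ k / (mfact a)%:R * moment a f *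
    (2^-1 * (\sum_i \sum_j xs a 0 i * xs a 0 j * dheat (madd (madd a (munit i)) (munit j)) t x)
    - ts a * \sum_i dheat (madd (madd a (munit i)) (munit i)) t x).
  (* The same reduction applied twice, from order k + 2 to order k. *)
  transitivity ((-1) ^+ k / (k.+1%:R * k.+2%:R) * (\sum_(a \in [set a | mdegree a = k])
    (mfact a)%:R^-1 * \sum_i \sum_j moment (madd (madd a (munit i)) (munit j)) f
       * dheat (madd (madd a (munit i)) (munit j)) t x)).
    rewrite (sum_munit (fun b => \sum_j moment (madd b (munit j)) f * dheat (madd b (munit j)) t x)).
    rewrite (sum_munit (fun b => moment b f * dheat b t x)).
    rewrite (_ : _ / _ * _ = (-1) ^+ k *
      \sum_(b \in [set b | mdegree b = k.+2]) (mfact b)%:R^-1 * (moment b f * dheat b t x)).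
      by rewrite !fsum_mdegree mulr_sumr; apply: eq_bigr => b _; rewrite !exprS; ring.
    move: k1n k2n; move: (k.+1%:R : R) (k.+2%:R : R) => p q p0 q0.
    by field; rewrite p0 q0.
  rewrite fsum_mdegree mulr_sumr -fsum_mdegree; apply: sum_Lambda.
    move=> a La.
    (* Hypothesis (a) with c_a = - t^{*,a} M_a: the off-diagonal part is the second-order term of
       the space shift, and the multiple of the identity gives a Laplacian, that is, the time
       shift. *)
    have E i j : moment (madd (madd a (munit i)) (munit j)) f / (k.+1%:R * k.+2%:R) =
        moment a f * (2^-1 * (xs a 0 i * xs a 0 j) - ts a * (i == j)%:R).
      have := cE La i j; have /eqP := tsE La; rewrite addr_eq0 => /eqP -> H.
      rewrite mulrC; move/eqP: H; rewrite subr_eq => /eqP ->.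
      by ring.
    transitivity ((-1) ^+ k / (mfact a)%:R * \sum_i \sum_j
      (moment (madd (madd a (munit i)) (munit j)) f / (k.+1%:R * k.+2%:R))
       * dheat (madd (madd a (munit i)) (munit j)) t x).
      rewrite !mulr_sumr; apply: eq_bigr => i _; rewrite !mulr_sumr; apply: eq_bigr => j _.
      by move: ((k.+1%:R * k.+2%:R)^-1) => q; ring.
    rewrite -[RHS]mulrA; congr (_ * _).
    rewrite !mulr_sumr -sumrB mulr_sumr; apply: eq_bigr => i _.
    transitivity (\sum_j (moment a f * (2^-1 * (xs a 0 i * xs a 0 j * dheat (madd (madd a (munit i)) (munit j)) t x))
       - (i == j)%:R * (moment a f * (ts a * dheat (madd (madd a (munit i)) (munit j)) t x)))).
      by apply: eq_bigr => j _; rewrite E; ring.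
    rewrite sumrB mulrBr !mulr_sumr; congr (_ - _).
    rewrite (bigD1 i)//= eqxx mul1r big1 ?addr0// => j ji.
    by rewrite eq_sym (negbTE ji) mul0r.
  move=> a ak aL; rewrite big1 ?mulr0// => i _; rewrite big1// => j _.
  have [_ H] := moment0 ak aL; rewrite -maddA H ?mul0r//.
  by rewrite mdegree_madd !mdegree_munit.
set S := \sum_(j < k) _.
have cancelS (p q r u : R) : S + p + q + r - (S + u) = p + q + r - u by ring.
rewrite cancelS.
rewrite !fsum_LambdaE -!big_split/= -sumrN -big_split/=; apply: eq_bigr => a _.
by rewrite /shift_expansion; ring.
Qed.

Lemma moment_expansion_modified_le : exists t1 C : R, [/\ 1 <= t1, 0 <= C &
  forall t x, t1 <= t ->
  `|moment_expansion f (k + 2).+1 t x - modified_heat_kernel k f xs ts t x| <=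
    C * Num.sqrt t ^- (k + 2).+1 * heat_kernel (8 * t) x].
Proof.
have /choice[C H] : forall a, exists C : R, 0 <= C /\ forall t x,
  1 + 2 * `|ts a| + enorm (xs a) ^+ 2 <= t ->
  `|shift_expansion a (ts a) (xs a) t x - dheat a (t - ts a) (x - xs a)| <=
    C * Num.sqrt t ^- (mdegree a).+3 * heat_kernel (8 * t) x.
  by move=> a; have [C ? ?] := shift_expansion_le a (ts a) (xs a); exists C.
pose r := finmap.enum_fset (fset_set (Lambda k f)).
pose T a := 1 + 2 * `|ts a| + enorm (xs a) ^+ 2.
have T0 a : 0 <= T a by rewrite addr_ge0 ?sqr_ge0// addr_ge0// mulr_ge0.
have inr a : (a \in r) = (a \in Lambda k f) by rewrite in_fset_set//; exact: finite_Lambda.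
(* The sum of the nonnegative thresholds [T a] exceeds each of them, and also each [ts a], so all
   shifted times are positive. *)
exists (1 + \sum_(a <- r) T a).
exists (\sum_(a <- r) `|(-1) ^+ k / (mfact a)%:R * moment a f| * C a); split.
- by rewrite lerDl sumr_ge0.
- by apply: sumr_ge0 => a _; rewrite mulr_ge0//; case: (H a).
move=> t x tge.
have t1 : 1 <= t by apply: le_trans tge; rewrite lerDl sumr_ge0.
have tT a : a \in r -> T a <= t.
  move=> ar; apply: le_trans tge.
  by rewrite (big_rem a)//= addrCA lerDl addr_ge0// sumr_ge0.
rewrite moment_expansion_modified; last 2 first.
- exact: lt_le_trans t1.
- move=> a La; have := tT a; rewrite inr mem_set// => /(_ isT); rewrite /T.
  have := ler_norm (ts a); have := normr_ge0 (ts a); have := sqr_ge0 (enorm (xs a)).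
  by lra.
rewrite fsum_LambdaE; apply: (le_trans (ler_norm_sum _ _ _)).
rewrite !mulr_suml big_seq [leRHS]big_seq; apply: ler_sum => a ar.
rewrite normrM -!mulrA ler_wpM2l// mulrA.
have [_ Ha] := H a; have := Ha t x (tT a ar).
suff -> : mdegree a = k by rewrite addn2.
by move: ar; rewrite inr => /set_mem [].
Qed.

End moment_matching.

(** * The limit in L^p *)

(** With q = 1/p, the factor t^(-(n/2)(1 - 1/p)) left by interpolation cancels against the power in
    the theorem; what remains is t^(m/2) for every p. *)
Lemma powR_sqrt_scaling (R : realType) (m n : nat) (t q : R) : 0 < t ->
  t `^ (m%:R / 2 + n%:R / 2 * (1 - q)) * (Num.sqrt t ^- n) `^ (1 - q) =
  Num.sqrt t ^+ m.
Proof.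
move=> t0.
have sE i : Num.sqrt t ^+ i = t `^ (i%:R / 2).
  by rewrite -powR12_sqrt ?(ltW t0)// -powR_mulrn ?powR_ge0// -powRrM mulrC.
rewrite !sE -powRN -powRrM -powRD; last by rewrite (gt_eqF t0) implybT.
by congr (_ `^ _); ring.
Qed.

Theorem theorem1p5 (R : realType) (n k : nat) (f : 'rV[R]_n -> R)
  (xs : mindex n -> 'rV[R]_n) (c ts : mindex n -> R) :
  (2 <= n)%N -> (1 <= k)%N ->
  (lebesgue_rV R n).-integrable setT (EFin \o f) ->
  (\int[lebesgue_rV R n]_x ((1 + enorm x) ^+ (k + 2) * `|f x|)%:E < +oo)%E ->
  Lambda k f !=set0 ->
  (forall a, Lambda k f a -> forall i : 'I_n,
    xs a 0 i = moment (madd a (munit i)) f / (k.+1%:R * moment a f)) ->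
  (forall a, Lambda k f a -> forall i j : 'I_n,
    (k.+1%:R * k.+2%:R)^-1 * moment (madd (madd a (munit i)) (munit j)) f
      - 2^-1 * moment a f * xs a 0 i * xs a 0 j = c a * (i == j)%:R) ->
  (forall a : mindex n, mdegree a = k -> ~ Lambda k f a ->
    (forall i : 'I_n, moment (madd a (munit i)) f = 0) /\
    (forall a' : mindex n, mdegree a' = 2%N -> moment (madd a a') f = 0)) ->
  (forall a, Lambda k f a -> c a + ts a * moment a f = 0) ->
  forall p : \bar R, (1 <= p)%E ->
    ((t `^ ((k + 2)%:R / 2 + n%:R / 2 * (1 - fine (p^-1)%E)))%:E *
      'N[lebesgue_rV R n]_p[(fun x =>
        (heat_solution f x t - modified_heat_kernel k f xs ts t x)%:E)])%E
      @[t --> +oo] --> 0%E.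
Proof.
move=> _ k1 fint fmom _ xsE cE moment0 tsE p p1.
have [C1 C10 H1] := heat_solution_expansion fint fmom.
have [t1 [C2 [t11 C20 H2]]] := moment_expansion_modified_le k1 xsE cE moment0 tsE.
set m := (k + 2)%N in fmom H1 H2 *.
(* The rescaled bound: the first term comes from the moment expansion, the second from the modified
   kernel, whose error is smaller by a factor 1/sqrt t. *)
pose h (t : R) := C1 * weighted_mass m f t + C2 * (Num.sqrt t)^-1.
have h0 : h t @[t --> +oo] --> (0 : R).
  have := cvgD (cvgM (cvg_cst C1) (cvg_weighted_mass fint fmom))
    (cvgM (cvg_cst C2) (@cvg_sqrtV_pinfty R)).
  by rewrite !mulr0 addr0; exact.
have {}h0 : (h t)%:E @[t --> +oo] --> 0%E by apply: cvg_EFin => //; exact: nearW.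
apply: squeeze_cvge (cvg_cst 0%E) h0; near=> t.
have tt1 : t1 <= t by near: t; apply: nbhs_pinfty_ge; rewrite num_real.
have t0 : 0 < t by apply: lt_le_trans tt1; exact: lt_le_trans t11.
have s0 : 0 < Num.sqrt t by rewrite sqrtr_gt0.
rewrite mule_ge0 ?lee_fin ?powR_ge0 ?Lnorm_ge0//=.
have [B [mB EB Bd IB]] := H1 t t0.
pose G (x : 'rV[R]_n) : \bar R := ((C2 * Num.sqrt t ^- m.+1)%:E * (heat_kernel (8 * t) x)%:E)%E.
have c0 : 0 <= C2 * Num.sqrt t ^- m.+1 by rewrite mulr_ge0// invr_ge0 exprn_ge0// ltW.
have mG8 : measurable_fun setT (fun x : 'rV[R]_n => (heat_kernel (8 * t) x)%:E).
  apply/measurable_EFinP; apply: measurable_heat_kernel_comp => i.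
  exact: measurable_coord.
have mG : measurable_fun setT G by apply: emeasurable_funM.
have G0 x : (0 <= G x)%E by rewrite mule_ge0// lee_fin heat_kernel_ge0.
have B0 x : (0 <= B x)%E by apply: le_trans (EB x); rewrite lee_fin.
(* The L^1 bound of the total error; its uniform bound is e t^(-n/2), as interpolation with dl =
   t^(-n/2) demands. *)
pose e := C1 * Num.sqrt t ^- m * weighted_mass m f t + C2 * Num.sqrt t ^- m.+1.
have e0 : 0 <= e.
  by rewrite addr_ge0// mulr_ge0 ?weighted_mass_ge0// mulr_ge0// invr_ge0 exprn_ge0// ltW.
have := @Lnorm_interpolation _ _ R (lebesgue_rV R n)
  (fun x => heat_solution f x t - modified_heat_kernel k f xs ts t x)
  (fun x => B x + G x)%E e (Num.sqrt t ^- n) p e0 _ p1 _ _ _ _.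
rewrite invr_ge0 exprn_ge0 ?(ltW s0)//.
have mBG : measurable_fun setT (fun x => B x + G x)%E by exact: emeasurable_funD.
have leBG x : (`|heat_solution f x t - modified_heat_kernel k f xs ts t x|%:E <= B x + G x)%E.
  rewrite -(subrKA (moment_expansion f m.+1 t x)).
  rewrite (le_trans (_ : _ <= `|heat_solution f x t - moment_expansion f m.+1 t x|%:E +
    `|moment_expansion f m.+1 t x - modified_heat_kernel k f xs ts t x|%:E)%E)//.
    by rewrite -EFinD lee_fin ler_normD.
  by apply: leeD => //; rewrite /G -EFinM lee_fin H2.
have BGd x : (B x + G x <= (e * Num.sqrt t ^- n)%:E)%E.
  rewrite /e mulrDl EFinD; apply: leeD => //.
  by rewrite /G -EFinM lee_fin ler_wpM2l// heat_kernel8_le.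
have IBG : (\int[lebesgue_rV R n]_x (B x + G x) <= e%:E)%E.
  rewrite ge0_integralD// /e EFinD; apply: leeD => //.
  rewrite ge0_integralZl//; last by move=> x _; rewrite lee_fin heat_kernel_ge0.
  by rewrite integral_heat_kernel0 ?mulr_gt0// mule1.
move=> /(_ isT mBG leBG BGd IBG) HN.
apply: (le_trans (lee_wpmul2l _ HN)); first by rewrite lee_fin powR_ge0.
rewrite -EFinM lee_fin mulrCA powR_sqrt_scaling// /e /h le_eqVlt.
apply/orP; left; apply/eqP; rewrite !exprS.
by field; rewrite ?expf_neq0 ?gt_eqF.
Unshelve. all: by end_near. Qed.
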